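(* There exists a randomized algorithm for $3$-SAT with one-sided error whose running time is $O(1.30704^n)$, where $n$ is the number of variables of the input formula.
   Context: $3$-SAT is the decision problem: given a CNF formula in which every clause has at most $3$ literals, over $n$ Boolean variables, decide whether it has a satisfying assignment. A randomized algorithm with one-sided error never wrongly reports an unsatisfiable formula as satisfiable (e.g. it answers ''satisfiable'' only when it has found a satisfying assignment), and on a satisfiable input it answers ''satisfiable'' with probability at least $1/2$ (or any fixed constant). *)

(* Defs.v *)
From HB Require Import structures.
From mathcomp Require Import all_boot all_order all_algebra.

Set Implicit Arguments.
Unset Strict Implicit.
Unset Printing Implicit Defensive.

Import Order.TTheory GRing.Theory Num.Theory.

(** CNF formulas over the variables 0, ..., n-1.  The literal (x, b) is true
    exactly when x is assigned b. *)

Definition literal (n : nat) : Type := ('I_n * bool)%type.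
Definition clause (n : nat) : Type := seq ('I_n * bool).
Definition cnf (n : nat) : Type := seq (seq ('I_n * bool)).

(** A CNF formula is a finite set of clauses, listed here in arbitrary order
    without repetition.  The [uniq] condition is what makes a running time
    depending on n alone meaningful: otherwise the input could be arbitrarily
    long for a fixed n. *)
Definition is_kcnf (k n : nat) (F : cnf n) : bool :=
  uniq F && all (fun C => size C <= k) F.

Definition satisfies (n : nat) (a : {ffun 'I_n -> bool}) (F : cnf n) : bool :=
  all (fun C : clause n => has (fun l : literal n => a l.1 == l.2) C) F.

Definition satisfiable (n : nat) (F : cnf n) : Prop :=
  exists a : {ffun 'I_n -> bool}, satisfies a F.

(** Model of computation: N. D. Jones's WHILE language over binary trees,
    extended with fair coin tosses.  Assignments build at most a fixed number
    of nodes and there is no unit-cost test of equality of trees (only a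
    test for [Leaf]), so that with shared nodes one step is a bounded number of
    pointer operations; the model is equivalent to probabilistic Turing
    machines up to a polynomial overhead in time. *)

Inductive tree : Type := Leaf | Node of tree & tree.

Definition hd (t : tree) : tree := if t is Node l _ then l else Leaf.
Definition tl (t : tree) : tree := if t is Node _ r then r else Leaf.
Definition is_leaf (t : tree) : bool := if t is Leaf then true else false.

Inductive expr : Type :=
  | EVar of nat
  | ELeaf
  | ENode of expr & expr
  | EHd of expr
  | ETl of expr.

Inductive prog : Type :=
  | Assign of nat & expr
  | Toss of nat
  | Seq of prog & prog
  | If of expr & prog & prog
  | While of expr & prog.

Definition store : Type := nat -> tree.

Definition upd (s : store) (x : nat) (v : tree) : store :=
  fun y => if y == x then v else s y.

Fixpoint eval (s : store) (e : expr) : tree :=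
  match e with
  | EVar x => s x
  | ELeaf => Leaf
  | ENode e1 e2 => Node (eval s e1) (eval s e2)
  | EHd e1 => hd (eval s e1)
  | ETl e1 => tl (eval s e1)
  end.

Definition bool_tree (b : bool) : tree := if b then Node Leaf Leaf else Leaf.

(** The programs still to be executed, in order, and the current store. *)
Definition config : Type := (seq prog * store)%type.

Definition halted (c : config) : bool := nilp c.1.

(** One unit of time.  A fresh coin b is supplied at every step, and is looked
    at only by [Toss]. *)
Definition step (c : config) (b : bool) : config :=
  let: (k, s) := c in
  match k with
  | [::] => c
  | Assign x e :: k' => (k', upd s x (eval s e))
  | Toss x :: k' => (k', upd s x (bool_tree b))
  | Seq p q :: k' => (p :: q :: k', s)
  | If e p q :: k' => ((if is_leaf (eval s e) then q else p) :: k', s)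
  | While e p :: k' =>
      if is_leaf (eval s e) then (k', s) else (p :: While e p :: k', s)
  end.

(** Variable 0 holds the input at the beginning and the answer at the end;
    all other variables are initially [Leaf]. *)
Definition init (p : prog) (x : tree) : config :=
  ([:: p], upd (fun=> Leaf) 0 x).

Definition run (p : prog) (x : tree) (r : seq bool) : config :=
  foldl step (init p x) r.

Definition accepting (c : config) : bool := halted c && ~~ is_leaf (c.2 0).

(** Worst case over the outcomes of the coin tosses. *)
Definition runs_in_time (p : prog) (x : tree) (t : nat) : Prop :=
  forall r : t.-tuple bool, halted (run p x r).

(** Probability that p has answered "yes" on x within t steps, over t
    independent fair coins.  As halted configurations are fixed by [step], it
    does not depend on t as soon as [runs_in_time p x t] holds. *)
Definition accept_prob (p : prog) (x : tree) (t : nat) : rat :=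
  (#|[set r : t.-tuple bool | accepting (run p x r)]|%:R / 2 ^+ t)%R.

(** Numbers are written in unary.  The input consists of n and the list of
    clauses, and has size polynomial in n for a k-CNF formula with k fixed. *)
Fixpoint nat_tree (m : nat) : tree :=
  if m is m'.+1 then Node Leaf (nat_tree m') else Leaf.

Definition seq_tree (A : Type) (f : A -> tree) (s : seq A) : tree :=
  foldr (fun a t => Node (f a) t) Leaf s.

Definition literal_tree (n : nat) (l : literal n) : tree :=
  Node (nat_tree l.1) (bool_tree l.2).

Definition cnf_tree (n : nat) (F : cnf n) : tree :=
  Node (nat_tree n) (seq_tree (seq_tree (@literal_tree n)) F).

(** T : nat -> nat is a worst-case running time, as a function of the number
    of variables, of p on k-CNF formulas. *)
Definition kSAT_running_time (k : nat) (p : prog) (T : nat -> nat) : Prop :=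
  forall (n : nat) (F : cnf n), is_kcnf k F -> runs_in_time p (cnf_tree F) (T n).

Definition kSAT_one_sided (k : nat) (p : prog) (T : nat -> nat) : Prop :=
  forall (n : nat) (F : cnf n), is_kcnf k F ->
    (satisfiable F -> (1 / 2 <= accept_prob p (cnf_tree F) (T n))%R) /\
    (~ satisfiable F -> accept_prob p (cnf_tree F) (T n) = 0%R).

(** T(n) = O(c^n). *)
Definition bigO_exp (T : nat -> nat) (c : rat) : Prop :=
  exists (K : rat) (n0 : nat), forall n : nat, n0 <= n ->
    ((T n)%:R <= K * c ^+ n)%R.

(* Main.v *)
From HB Require Import structures.
From mathcomp Require Import boolp classical_sets functions reals topology normedtype.
From mathcomp Require Import sequences derive realfun exp.
From mathcomp Require Import all_boot all_order all_algebra.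
From mathcomp Require Import ring lra zify.
Require Import Defs.

(** PPSZ assigns the variables in a random order, each one to the value that a
    bounded-depth refutation search forces on it if there is such a value, and
    to a random value otherwise.  As in Hertli's analysis, every unassigned
    variable is given a cost: the PPSZ rate if both its values are still
    possible, and otherwise the probability that it will not be forced, averaged
    over the satisfying assignments with a suitable likelihood.  One step of the
    algorithm does not decrease, on average, the quantity [2 ^ - total cost].
    The critical clause tree bounds each cost by [2 ln 2 - 1 + 1 / (d + 1)] for
    refutations of depth [d], so one run succeeds with probability at least
    [2 ^ - (141 n / 365)] when [d] is large; repeating it [2 ^ (141 n / 365)]
    times takes time [O (1.30704 ^ n)] since [2 ^ 141 < 1.30704 ^ 365].

    To run it as a WHILE program, its deterministic parts are compiled from a
    small language with clock-bounded loops; repetition uses a stack on which a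
    list of length [m] stands for [2 ^ m] runs. *)

Set Implicit Arguments.
Unset Strict Implicit.
Unset Printing Implicit Defensive.

Import Order.TTheory GRing.Theory Num.Theory.
Import numFieldNormedType.Exports.

(** * Random subsets and integration of polynomials *)

(** The obstacle is that a variable has a critical clause only if it is frozen, that is, if all
    remaining solutions agree on it. A liquid variable can be guessed either way without losing
    satisfiability, and these two good outcomes pay for the rise of its cost. A random order is
    modelled by independent uniform arrival times: if [x] arrives at time [q], every other variable
    precedes it with probability [q], so a mean over orders is the integral over [q] of a
    polynomial. Branches of a critical clause tree may share variables and so are not independent;
    Harris' inequality says that they are positively correlated, which is the direction needed.
    Since [ln 2 < 253 / 365], the limit rate [2 ln 2 - 1] lies strictly below
    [2 * (253 / 365) - 1 = 141 / 365]. This gap absorbs the finite depth and the bias of choosing a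
    variable with fair coins; the gap between [2 ^ (141 / 365)] and [1.30704] absorbs the polynomial
    factors. *)

Section RandomSubset.
Variables (R : realFieldType) (T : finType).
Implicit Types (vs : seq T) (f g : {set T} -> R) (q : R).
Local Open Scope ring_scope.

(* The mean of [f] over the random subset of [vs] in which every element lies
   with probability ['X], as a polynomial in that probability. *)
Fixpoint bern vs f : {poly R} :=
  if vs is y :: vs' then
    'X * bern vs' (fun B => f (y |: B)) + (1 - 'X) * bern vs' f
  else (f set0)%:P.

Lemma eq_bern vs f g : f =1 g -> bern vs f = bern vs g.
Proof.
elim: vs f g => [|y vs IH] f g fg /=; first by rewrite fg.
by rewrite (IH _ _ fg) (IH _ (fun B => g (y |: B))) // => B; rewrite fg.
Qed.

Lemma bern_cst vs (c : R) : bern vs (fun=> c) = c%:P.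
Proof. by elim: vs => [|y vs IH] //=; rewrite IH; ring. Qed.

Lemma bern_rem vs y f : y \in vs -> bern vs f = bern (y :: rem y vs) f.
Proof.
elim: vs f => [|z vs IH] f //=; rewrite in_cons eq_sym.
case: eqVneq => [->//|zy] /= yvs.
rewrite !IH //= (@eq_bern _ _ (fun B => f (y |: (z |: B)))) => [|B]; first ring.
by rewrite setUCA.
Qed.

Lemma bern_ge0 vs f q : 0 <= q <= 1 -> (forall B, 0 <= f B) -> 0 <= (bern vs f).[q].
Proof.
move=> /andP[q0 q1]; elim: vs f => [|y vs IH] f f0 /=; first by rewrite hornerC.
rewrite !hornerE; apply: addr_ge0; apply: mulr_ge0; rewrite ?subr_ge0 //; exact: IH.
Qed.

Lemma bernB vs f g : bern vs (fun B => f B - g B) = bern vs f - bern vs g.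
Proof. by elim: vs f g => [|y vs IH] f g /=; [rewrite polyCB | rewrite !IH; ring]. Qed.

Lemma ler_bern vs f g q : 0 <= q <= 1 -> (forall B, f B <= g B) ->
  (bern vs f).[q] <= (bern vs g).[q].
Proof.
move=> q01 fg; rewrite -subr_ge0 -hornerN -hornerD -bernB.
by apply: bern_ge0 => // B; rewrite subr_ge0.
Qed.

Lemma bern_horner0 vs f : (bern vs f).[0] = f set0.
Proof. by elim: vs f => [|y vs IH] f /=; rewrite !hornerE ?IH; ring. Qed.

(** Harris' inequality. After conditioning on [y], the induction hypothesis settles both halves, and
    what remains is Chebyshev's inequality on two points: [q (1 - q) (f1 - f0) (g1 - g0) >= 0]. *)
Lemma bern_harris vs f g q : 0 <= q <= 1 ->
    (forall B B' : {set T}, B \subset B' -> f B <= f B') ->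
    (forall B B' : {set T}, B \subset B' -> g B <= g B') ->
  (bern vs f).[q] * (bern vs g).[q] <= (bern vs (fun B => f B * g B)).[q].
Proof.
move=> q01; have /andP[q0 q1] := q01.
elim: vs f g => [|y vs IH] f g fm gm /=; first by rewrite !hornerC.
rewrite !hornerE.
have mono h : (forall B B' : {set T}, B \subset B' -> h B <= h B') ->
    forall B B' : {set T}, B \subset B' -> h (y |: B) <= h (y |: B') :> R.
  by move=> hm B B' BB'; apply: hm; exact: setUS.
have le1 h : (forall B B' : {set T}, B \subset B' -> h B <= h B') ->
    (bern vs h).[q] <= (bern vs (fun B => h (y |: B))).[q].
  by move=> hm; apply: ler_bern => // B; apply: hm; exact: subsetUr.
have := IH _ _ (mono _ fm) (mono _ gm); have := IH _ _ fm gm.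
have := le1 _ fm; have := le1 _ gm.
set f0 := (bern vs f).[q]; set f1 := (bern vs (fun B => f (y |: B))).[q].
set g0 := (bern vs g).[q]; set g1 := (bern vs (fun B => g (y |: B))).[q].
set h0 := _.[q]; set h1 := _.[q] => gle fle h0le h1le.
apply: (@le_trans _ _ (q * (f1 * g1) + (1 - q) * (f0 * g0))); last first.
  by apply: lerD; apply: ler_wpM2l; rewrite ?subr_ge0.
have : 0 <= q * (1 - q) * ((f1 - f0) * (g1 - g0)).
  by rewrite !mulr_ge0 ?subr_ge0.
lra.
Qed.

(** Harris' inequality along a clause: [E l] will say that the branch of [l] is closed, and only the
    literals not closed in advance by [P] cost a factor [s]. *)
Lemma bern_all (L : eqType) (C : seq L) (E : L -> {set T} -> bool) (P : pred L)
    vs (s : R) q :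
    0 <= q <= 1 -> 0 <= s ->
    (forall l (B B' : {set T}), B \subset B' -> E l B -> E l B') ->
    (forall l B, P l -> E l B) ->
    (forall l, l \in C -> ~~ P l -> s <= (bern vs (fun B => (E l B)%:R)).[q]) ->
  s ^+ count (predC P) C <= (bern vs (fun B => (all (E^~ B) C)%:R)).[q].
Proof.
move=> q01 s0 Em PE; elim: C => [|l C IH] sE /=.
  by rewrite bern_cst hornerC expr0.
have mono l' : forall B B' : {set T}, B \subset B' -> (E l' B)%:R <= (E l' B')%:R :> R.
  by move=> B B' BB'; rewrite ler_nat; move: (Em l' _ _ BB'); case: (E l' B) => // ->.
have monoC (B B' : {set T}) : B \subset B' ->
    (all (E^~ B) C)%:R <= (all (E^~ B') C)%:R :> R.
  move=> BB'; rewrite ler_nat; case: (boolP (all _ C)) => // H.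
  rewrite (_ : all _ C) //; apply: sub_all H => l'; exact: Em BB'.
rewrite (@eq_bern _ _ (fun B => (E l B)%:R * (all (E^~ B) C)%:R)); last first.
  by move=> B; rewrite -natrM mulnb.
apply: le_trans (bern_harris _ q01 (mono l) monoC).
rewrite exprD; apply: ler_pM; rewrite ?exprn_ge0 //; last first.
  by apply: IH => l' l'C; apply: sE; rewrite in_cons l'C orbT.
case: (boolP (P l)) => Pl /=.
  rewrite expr0 (@eq_bern _ _ (fun=> 1)) ?bern_cst ?hornerC // => B.
  by rewrite PE.
by rewrite expr1; apply: sE => //; rewrite mem_head.
Qed.

Lemma deriv_bern vs f : uniq vs ->
  (1 - 'X) * (bern vs f)^`() =
  \sum_(y <- vs) (bern (rem y vs) (fun B => f (y |: B)) - bern vs f).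
Proof.
elim: vs f => [|y vs IH] f /=; first by rewrite big_nil derivC mulr0.
case/andP=> yvs uvs; rewrite big_cons eqxx.
have -> : \sum_(z <- vs) (bern (if y == z then vs else y :: rem z vs)
     (fun B => f (z |: B)) - ('X * bern vs (fun B => f (y |: B)) + (1 - 'X) * bern vs f))
  = 'X * \sum_(z <- vs) (bern (rem z vs) (fun B => f (y |: (z |: B))) - bern vs (fun B => f (y |: B)))
   + (1 - 'X) * \sum_(z <- vs) (bern (rem z vs) (fun B => f (z |: B)) - bern vs f).
  rewrite !big_distrr -big_split /=; apply: eq_big_seq => z zvs.
  case: eqVneq => [yz|_] /=; first by rewrite yz zvs in yvs.
  rewrite (@eq_bern _ _ (fun B => f (y |: (z |: B)))) => [|B]; first ring.
  by rewrite setUCA.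
rewrite -!IH // derivD !derivM derivB derivX derivC; ring.
Qed.

End RandomSubset.

(** * Integrals over the arrival time *)

Section Integral.
Variable R : realFieldType.
Local Open Scope ring_scope.
Implicit Types p r : {poly R}.

(* The primitive of [p] vanishing at 0; the constant coefficient is [_ / 0 = 0]. *)
Definition prim p : {poly R} := \poly_(i < (size p).+1) (p`_i.-1 / i%:R).

Definition integ p : R := (prim p).[1].

Lemma coef_prim p i : (prim p)`_i = p`_i.-1 / i%:R.
Proof.
rewrite coef_poly; case: ltnP => // hi; rewrite nth_default ?mul0r //.
by case: i hi.
Qed.

Lemma deriv_prim p : (prim p)^`() = p.
Proof.
apply/polyP => i; rewrite coef_deriv coef_prim /=.
by rewrite -(mulr_natr (_ / _)) divfK // pnatr_eq0.
Qed.

Lemma prim_horner0 p : (prim p).[0] = 0.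
Proof. by rewrite horner_coef0 coef_prim invr0 mulr0. Qed.

Lemma prim_is_linear (a : R) p r : prim (a *: p + r) = a *: prim p + prim r.
Proof. by apply/polyP => i; rewrite !(coefD, coefZ, coef_prim); ring. Qed.

Lemma integD p r : integ (p + r) = integ p + integ r.
Proof. by rewrite /integ -[p]scale1r prim_is_linear !scale1r hornerD. Qed.

Lemma integB p r : integ (p - r) = integ p - integ r.
Proof.
by rewrite /integ addrC -scaleN1r prim_is_linear scaleN1r hornerD hornerN addrC.
Qed.

Lemma integ_sum I (s : seq I) (F : I -> {poly R}) :
  integ (\sum_(i <- s) F i) = \sum_(i <- s) integ (F i).
Proof.
elim: s => [|i s IH]; last by rewrite !big_cons integD IH.
by rewrite !big_nil -[0 in LHS](subrr 0) integB subrr.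
Qed.

Lemma integ_deriv p : integ p^`() = p.[1] - p.[0].
Proof.
rewrite /integ; have -> : prim p^`() = p - (p`_0)%:P.
  apply/polyP => i; rewrite coef_prim coefB coefC coef_deriv.
  case: i => [|i] /=; first by rewrite invr0 mulr0 subrr.
  by rewrite -[p`_i.+1 *+ _]mulr_natr mulfK ?pnatr_eq0 // subr0.
by rewrite hornerD hornerN hornerC horner_coef0.
Qed.

(** Let [A] be the mean of [f] over the predecessors of an extra element in a random order of it and
    the [m] elements of [vs]. The claim is [(m + 1) A = f set0 + \sum A_y]: either the extra element
    comes first or some [y] does. Analytically, [('X - 1) * bern vs f] is differentiated and
    integrated back. *)
Lemma integ_bern (T : finType) (vs : seq T) (f : {set T} -> R) : uniq vs ->
  integ (bern vs f) +
  \sum_(y <- vs) (integ (bern vs f) - integ (bern (rem y vs) (fun B => f (y |: B)))) =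
  f set0.
Proof.
move=> uvs; under eq_bigr do rewrite -integB.
rewrite -integ_sum -integD.
have -> : bern vs f + \sum_(y <- vs) (bern vs f - bern (rem y vs) (fun B => f (y |: B)))
  = (('X - 1) * bern vs f)^`().
  rewrite derivM derivB derivX derivC subr0 mul1r; congr (_ + _).
  rewrite -[RHS]opprK -mulNr opprB deriv_bern // -sumrN.
  by apply: eq_bigr => y _; rewrite opprB.
by rewrite integ_deriv !hornerE bern_horner0; ring.
Qed.

End Integral.

(** * The recursion of the critical clause tree *)

Section Analysis.
Variable R : realType.
Local Open Scope ring_scope.
Local Open Scope classical_set_scope.
Implicit Types p u : {poly R}.

(** Integration is only defined for polynomials here; a comparison with a transcendental primitive
    is made through the mean value theorem instead. *)
Lemma horner_mvt_le p (G g : R -> R) (a b : R) : a <= b ->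
    (forall x : R, a <= x <= b -> is_derive x (1 : R) G (g x)) ->
    (forall x : R, a <= x <= b -> p^`().[x] <= g x) ->
  p.[b] - p.[a] <= G b - G a.
Proof.
move=> ab dG pg.
have dGp (x : R) : a <= x <= b ->
    is_derive x (1 : R) (G - horner p : R -> R) (g x - p^`().[x]).
  by move=> /dG ?; exact: is_deriveB.
have [|x|c cab] := @MVT_segment R (G - horner p) (fun x => g x - p^`().[x]) a b ab.
- by move=> x /itvP xab; apply: dGp; rewrite !xab.
- by apply: derivable_within_continuous => y /itvP yab; have [] := dGp y;
    rewrite ?yab.
rewrite in_itv /= in cab.
have : 0 <= (g c - p^`().[c]) * (b - a).
  by rewrite mulr_ge0 ?subr_ge0 // pg.
move=> h e.
have {}e : (G b - p.[b]) - (G a - p.[a]) = (g c - p^`().[c]) * (b - a) := e.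
by rewrite -e in h; lra.
Qed.

Lemma integ_ge0 p : (forall x, 0 <= x <= 1 -> 0 <= p.[x]) -> 0 <= integ p.
Proof.
move=> p0.
have : (- prim p).[1] - (- prim p).[0] <= 0 - 0.
  apply: (@horner_mvt_le _ (fun=> 0) (fun=> 0)) => // x x01.
  by rewrite derivN deriv_prim hornerN oppr_le0 p0.
by rewrite !hornerN prim_horner0 subr0 oppr0 subr0 oppr_le0.
Qed.

(* The probability that a root-to-leaf cut of the complete binary tree of depth
   [d] is formed when every node but the root is chosen with probability [q]. *)
Fixpoint cutp (q : R) d : R :=
  if d is d'.+1 then (q + (1 - q) * cutp q d') ^+ 2 else 0.

Lemma cutp01 q d : 0 <= q <= 1 -> 0 <= cutp q d <= 1.
Proof.
move=> /andP[q0 q1]; elim: d => [|d /andP[c0 c1]] /=; first by rewrite lexx ler01.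
rewrite exprn_ge0 ?addr_ge0 ?mulr_ge0 ?subr_ge0 //= exprn_ile1 //.
  by rewrite addr_ge0 ?mulr_ge0 ?subr_ge0.
have : (1 - q) * cutp q d <= (1 - q) * 1 by rewrite ler_wpM2l ?subr_ge0.
lra.
Qed.

(* [(q / (1 - q))^2] is the smaller fixed point of the recursion, towards
   which it is contracting with rate [2 q] when [q <= 1/2]. *)
Lemma cutp_lower q d : 0 <= q <= 1 / 2 ->
  (q / (1 - q)) ^+ 2 - (2 * q) ^+ d <= cutp q d <= (q / (1 - q)) ^+ 2.
Proof.
move=> /andP[q0 q2]; set t := q / (1 - q).
have q1 : 0 < 1 - q by lra.
have t0 : 0 <= t by rewrite divr_ge0 // ltW.
have tq : t * (1 - q) = q by rewrite divfK // gt_eqF.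
have t1 : t <= 1 by rewrite ler_pdivrMr //; lra.
elim: d => [|d /andP[lo up]] /=.
  by rewrite expr0 sqr_ge0 andbT subr_le0 exprn_ile1.
have c0 : 0 <= cutp q d by case/andP: (@cutp01 q d (ltac:(lra))).
set s := q + _; have s0 : 0 <= s by rewrite addr_ge0 ?mulr_ge0 // ltW.
have ts : t - s = (1 - q) * (t ^+ 2 - cutp q d).
  have : t * q = t * (t * (1 - q)) by rewrite tq.
  by rewrite /s; lra.
have st : s <= t by rewrite -subr_ge0 ts mulr_ge0 ?subr_ge0 //; lra.
apply/andP; split; last by apply: lerXn2r; rewrite ?nnegrE.
suff : (t - s) * (t + s) <= (2 * q) ^+ d.+1 by rewrite -subr_sqr; lra.
apply: (@le_trans _ _ ((t - s) * (2 * t))).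
  by apply: ler_wpM2l; lra.
have -> : (t - s) * (2 * t) = 2 * (t * (1 - q)) * (t ^+ 2 - cutp q d) by rewrite ts; ring.
by rewrite tq [(2 * q) ^+ _]exprS ler_wpM2l //; lra.
Qed.

(** From [q = 1/2] on, the recursion is attracted by its fixed point 1: with
    [e = (1 - q) * (1 - cutp q d)] the next defect is [1 - (1 - e) ^+ 2 <= 2 * e]. *)
Lemma cutp_upper q d : 1 / 2 <= q <= 1 -> 1 - cutp q d <= (2 * (1 - q)) ^+ d.
Proof.
move=> /andP[q2 q1]; elim: d => [|d IH] /=; first by rewrite expr0 subr0.
have /andP[c0 c1] : 0 <= cutp q d <= 1 by apply: cutp01; lra.
rewrite [(2 * (1 - q)) ^+ _]exprS; apply: (@le_trans _ _ (2 * (1 - q) * (1 - cutp q d))); last first.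
  by rewrite ler_wpM2l //; lra.
have -> : q + (1 - q) * cutp q d = 1 - (1 - q) * (1 - cutp q d) by ring.
have : 0 <= ((1 - q) * (1 - cutp q d)) ^+ 2 by exact: sqr_ge0.
lra.
Qed.

(** [2 ln 2 - 1] is the integral of [1 - (q / (1 - q))^2] over [[0, 1/2]]. The errors [(2 q)^d]
    below 1/2 and [(2 (1 - q))^d] above it integrate to [1 / (2 (d + 1))] each. *)
Definition ppsz_rate d : R := 2 * ln 2 - 1 + d.+1%:R^-1.

Lemma is_derive_cut_primitive (x : R) : x < 1 ->
  is_derive x (1 : R) (fun r : R => - 2 * ln (1 - r) - (1 - r)^-1)
                      (1 - (x / (1 - x)) ^+ 2).
Proof.
move=> x1; have x0 : 0 < 1 - x by lra.
have h1 : is_derive x (1 : R) (fun r : R => 1 - r) (- 1).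
  by apply: is_derive_eq; rewrite add0r mul1r.
have := @is_derive1_ln R (1 - x) x0 => h2.
have h3 : is_derive x (1 : R) (fun r : R => ln (1 - r)) ((1 - x)^-1 * -1).
  exact: is_derive1_comp.
have h4 := @is_deriveV R (fun r : R => 1 - r) x (-1) 1 (lt0r_neq0 x0) h1.
have h5 := is_deriveB (is_deriveZ (-2) h3) h4.
apply: (is_derive_eq h5); rewrite /GRing.scale /=; field; lra.
Qed.

Lemma integ_le_ppsz_rate u d :
  (forall q, 0 <= q <= 1 -> u.[q] <= 1 - cutp q d) -> integ u <= ppsz_rate d.
Proof.
move=> uQ.
pose k : R := (2 * d.+1%:R)^-1.
have k0 : 2 * k = d.+1%:R^-1 by rewrite /k invfM mulrA divff ?mul1r ?pnatr_eq0.
(* [E1] and [- E2] are primitives of the two error terms, and [k] is the integral of each over its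
   half of the interval. *)
pose E1 : {poly R} := k *: (2 *: 'X) ^+ d.+1.
pose E2 : {poly R} := k *: (2 *: (1 - 'X)) ^+ d.+1.
have k1 (y : R) : k * (2 * y *+ d.+1) = y.
  by rewrite -[_ *+ d.+1]mulr_natr mulrAC mulrA mulVf ?mul1r // mulf_neq0 ?pnatr_eq0.
have dE1 x : E1^`().[x] = (2 * x) ^+ d.
  by rewrite /E1 derivZ deriv_exp derivZ derivX /= hornerZ hornerMn !hornerE; exact: k1.
have dE2 x : E2^`().[x] = - (2 * (1 - x)) ^+ d.
  rewrite /E2 derivZ deriv_exp derivZ derivB derivX derivC /=.
  rewrite hornerZ hornerMn !hornerE.
  rewrite mulrN1 mulNr mulNrn mulrN; congr (- _); exact: k1.
have lo := @horner_mvt_le (prim u - E1) (fun r : R => - 2 * ln (1 - r) - (1 - r)^-1)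
  (fun x => 1 - (x / (1 - x)) ^+ 2) 0 (1 / 2).
have hi := @horner_mvt_le (prim u + E2) (fun=> 0) (fun=> 0) (1 / 2) 1.
have {}lo : (prim u - E1).[1 / 2] - (prim u - E1).[0] <= 2 * ln 2 - 1.
  apply: le_trans (lo _ _ _) _; first lra.
  - by move=> x x2; apply: is_derive_cut_primitive; lra.
  - move=> x x2; rewrite derivB hornerD hornerN deriv_prim dE1.
    have := uQ x (ltac:(lra)); have := @cutp_lower x d x2; lra.
  - have -> : 1 - 1 / 2 = 2^-1 :> R by field.
    by rewrite subr0 ln1 invr1 lnV ?posrE // invrK; lra.
have {}hi : (prim u + E2).[1] - (prim u + E2).[1 / 2] <= 0.
  apply: le_trans (hi _ _ _) _; [lra | |by rewrite subrr].
    move=> x x2; rewrite derivD hornerD deriv_prim dE2.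
    have := uQ x (ltac:(lra)); have := @cutp_upper x d x2; lra.
move: lo hi; rewrite !(hornerD, hornerN) prim_horner0 -/(integ u) /ppsz_rate -k0.
have -> : E1.[0] = 0 by rewrite /E1 !hornerE expr0n mulr0.
have -> : E1.[1 / 2] = k.
  by rewrite /E1 hornerZ horner_exp hornerZ hornerX (_ : 2 * (1 / 2) = 1) ?expr1n ?mulr1 //; lra.
have -> : E2.[1] = 0 by rewrite /E2 !hornerE subrr mulr0 expr0n mulr0.
have -> : E2.[1 / 2] = k.
  rewrite /E2 hornerZ horner_exp hornerZ hornerD hornerN hornerX hornerC (_ : 2 * (1 - 1 / 2) = 1) ?expr1n ?mulr1 //; lra.
lra.
Qed.

End Analysis.

(** * Refutations and likelihood *)

Section Refutation.
Variables (n : nat) (F : cnf n).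
Implicit Types (rho : seq (literal n)) (a : {ffun 'I_n -> bool}).

Definition neg (l : literal n) : literal n := (l.1, ~~ l.2).

(** [rho] lists the literals assumed true. For fixed [d] the search is polynomial, and it follows a
    critical clause tree downwards: a literal is closed if it is false already or if assuming it is
    refuted one level below. *)
Fixpoint refuted d rho : bool :=
  if d is d'.+1 then
    has (fun C : clause n =>
      all (fun l : literal n => (neg l \in rho) || refuted d' (l :: rho)) C) F
  else false.

Definition agrees a rho := all (fun l : literal n => a l.1 == l.2) rho.

Definition forced d rho (x : 'I_n) (b : bool) := refuted d ((x, ~~ b) :: rho).

Lemma refuted_sub d rho rho' :
  {subset rho <= rho'} -> refuted d rho -> refuted d rho'.
Proof.
elim: d rho rho' => [|d IH] rho rho' sub //= /hasP[C CF Call].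
apply/hasP; exists C => //; apply: sub_all Call => l /orP[/sub->//|h].
apply/orP; right; apply: IH h => m; rewrite !in_cons => /orP[->//|/sub->].
by rewrite orbT.
Qed.

Lemma refuted_mem d rho rho' : rho =i rho' -> refuted d rho = refuted d rho'.
Proof. by move=> e; apply/idP/idP; apply: refuted_sub => l; rewrite e. Qed.

Lemma refuted_sound d rho a :
  satisfies a F -> agrees a rho -> ~~ refuted d rho.
Proof.
move=> aF; elim: d rho => [|d IH] rho arho //=.
apply/hasPn => C CF; apply/negP => /allP Call.
have /hasP[l lC al] := allP aF _ CF.
have /orP[/(allP arho)|] := Call _ lC.
  by rewrite /= (eqP al); case: l.2.
by apply/negP/IH; rewrite /= al.
Qed.

Lemma forced_sound d rho x b a :
  satisfies a F -> agrees a rho -> forced d rho x b -> a x = b.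
Proof.
move=> aF arho xb; apply/eqP; apply: contraLR xb => axb.
apply: (refuted_sound _ aF); rewrite /= arho andbT.
by case: (a x) b axb => -[].
Qed.

Definition sols rho : {set {ffun 'I_n -> bool}} :=
  [set a | satisfies a F && agrees a rho].

End Refutation.

(** * Liquid variables and the likelihood of a solution *)

Section Likelihood.
Variables (R : realFieldType) (n : nat).
Local Notation T := {ffun 'I_n -> bool}.
Implicit Types (S : {set T}) (a : T) (y z : 'I_n) (b c : bool).
Local Open Scope ring_scope.

Definition restr S y b : {set T} := [set a in S | a y == b].

Definition liquid S : {set 'I_n} :=
  [set y | (restr S y true != set0) && (restr S y false != set0)].

Lemma mem_restr S y a : a \in S -> a \in restr S y (a y).
Proof. by rewrite inE eqxx andbT. Qed.

Lemma liquidP S y b a : a \in S ->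
  (y \in liquid S) = (restr S y (a y) != set0) && (restr S y (~~ a y) != set0).
Proof. by rewrite inE; case: (a y) => //= _; rewrite andbC. Qed.

Lemma restr_frozen S y b a :
  a \in S -> y \notin liquid S -> restr S y b = if b == a y then S else set0.
Proof.
move=> aS; rewrite (liquidP y b aS).
have -> /= : restr S y (a y) != set0.
  by apply/set0Pn; exists a; exact: mem_restr.
rewrite negbK => /eqP e.
have e' : restr S y (a y) = S.
  apply/setP => a'; rewrite inE; case a'S: (a' \in S) => //=.
  apply: contraFT (in_set0 a'); rewrite -e inE a'S /=.
  by case: (a y) (a' y) => -[].
by case: eqVneq => [->//|]; case: b (a y) e e' => -[].
Qed.

Lemma restrC S y b z c : restr (restr S y b) z c = restr (restr S z c) y b.
Proof. by apply/setP => a; rewrite !inE andbAC. Qed.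

Lemma restr_sub S y b : restr S y b \subset S.
Proof. by apply/subsetP => a; rewrite inE => /andP[]. Qed.

Lemma liquid_sub S S' : S \subset S' -> liquid S \subset liquid S'.
Proof.
move=> /subsetP sub; apply/subsetP => y; rewrite !inE.
move=> /andP[/set0Pn[a] + /set0Pn[a']]; rewrite !inE.
move=> /andP[/sub aS e] /andP[/sub a'S e'].
by apply/andP; split; apply/set0Pn; [exists a | exists a']; rewrite inE ?aS ?a'S.
Qed.

Lemma liquid_restr S y b : liquid (restr S y b) \subset liquid S :\ y.
Proof.
apply/subsetP => z zl; rewrite in_setD1 (subsetP (liquid_sub (restr_sub S y b))) //.
rewrite andbT; apply: contraL zl => /eqP ->; rewrite !inE negb_and !negbK.
case: b; apply/orP; [right | left]; apply/eqP/setP => a; rewrite !inE;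
  by case: (a y); rewrite ?andbF.
Qed.

Lemma card_liquid_restr S y b : y \in liquid S ->
  (#|liquid (restr S y b)| < #|liquid S|)%N.
Proof.
move=> yl; apply: leq_ltn_trans (subset_leq_card (liquid_restr S y b)) _.
by rewrite [in ltnRHS](cardsD1 y) yl.
Qed.

Lemma liquid0 S a : a \in S -> liquid S = set0 -> S = [set a].
Proof.
move=> aS S0; apply/setP => a'; rewrite inE; apply/idP/eqP => [a'S|->//].
apply/ffunP => y; have: y \notin liquid S by rewrite S0 inE.
move=> yS; have := mem_restr y a'S; rewrite (restr_frozen _ aS yS).
by case: eqVneq => //; rewrite inE.
Qed.

(* [k] is fuel: [lk] below supplies enough of it. *)
Fixpoint lkf k S a : R :=
  if k is k'.+1 then
    if liquid S == set0 then 1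
    else (\sum_(y in liquid S) lkf k' (restr S y (a y)) a) / (2 * #|liquid S|%:R)
  else 1.

(* Hertli's likelihood: the probability that [a] is the result of repeatedly
   fixing a variable uniformly among the pairs (variable, value) for which the
   variable is still undetermined. *)
Definition lk S a : R := lkf #|liquid S| S a.

Lemma lkf_fuel k k' S a :
  (#|liquid S| <= k)%N -> (#|liquid S| <= k')%N -> lkf k S a = lkf k' S a.
Proof.
elim: k k' S => [|k IH] [|k'] S //=; rewrite ?leqn0 ?cards_eq0.
- by move=> ->.
- by move=> _ ->.
move=> Sk Sk'; case: ifP => // _; congr (_ / _); apply: eq_bigr => y yl.
by apply: IH; rewrite -ltnS; apply: leq_trans (card_liquid_restr _ yl) _.
Qed.

Lemma lk0 S a : liquid S = set0 -> lk S a = 1.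
Proof. by rewrite /lk => ->; rewrite cards0. Qed.

Lemma lkE S a : liquid S != set0 ->
  2 * #|liquid S|%:R * lk S a = \sum_(y in liquid S) lk (restr S y (a y)) a.
Proof.
move=> S0; have L0 : #|liquid S|%:R != 0 :> R by rewrite pnatr_eq0 cards_eq0.
rewrite /lk; move eL: #|liquid S| => L; case: L eL => [|L] /= eL.
  by rewrite eL eqxx in L0.
rewrite (negPf S0) mulrC eL divfK ?mulf_neq0 ?pnatr_eq0 //.
apply: eq_bigr => y yl; apply: lkf_fuel => //.
by rewrite -ltnS -eL; exact: card_liquid_restr.
Qed.

Lemma lk_ge0 S a : 0 <= lk S a.
Proof.
rewrite /lk; move: #|liquid S| => k; elim: k S => [|k IH] S //=; case: ifP => // _.
by rewrite divr_ge0 ?mulr_ge0 ?sumr_ge0.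
Qed.

(** The values of a liquid variable split [S] into two nonempty parts, on each of which the
    likelihoods sum to 1 by induction; this accounts for the 2 in [2 * #|liquid S|]. *)
Lemma lk_sum S : S != set0 -> \sum_(a in S) lk S a = 1.
Proof.
have [k] := ubnP #|liquid S|; elim: k S => // k IH S; rewrite ltnS => Sk S0.
have [L0|L0] := eqVneq (liquid S) set0.
  have [a aS] := set0Pn _ S0.
  by rewrite {1}(liquid0 aS L0) big_set1 lk0.
have LP : 2 * #|liquid S|%:R != 0 :> R.
  by rewrite mulf_neq0 ?pnatr_eq0 ?cards_eq0.
apply: (mulfI LP); rewrite mulr1 big_distrr /=.
under eq_bigr do rewrite lkE //.
rewrite exchange_big /= mulr_natr -sumr_const; apply: eq_bigr => y yl.
rewrite (bigID (fun a : T => a y)) /=.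
have split b : \sum_(a in S | a y == b) lk (restr S y (a y)) a = 1.
  rewrite -[RHS](IH (restr S y b)).
  - rewrite [RHS](eq_bigl (fun a => (a \in S) && (a y == b))); last first.
      by move=> a; rewrite inE.
    by apply: eq_bigr => a /andP[_ /eqP->].
  - exact: leq_trans (card_liquid_restr _ yl) _.
  - by move: yl; rewrite inE => /andP[]; case: b.
rewrite -[2]/(1 + 1) -{1}(split true) -(split false); congr (_ + _).
  by apply: eq_bigl => a; rewrite eqb_id.
by apply: eq_bigl => a; rewrite eqbF_neg.
Qed.

(** Fixing [z] commutes with the recursion. Variables of [L] that are frozen in [S'] contribute
    [lk S' a] once instead of twice, so the total weight is [2 #|L'| + #|L :\: L'| <= 2 #|L|]. *)
Lemma lk_restr S z a : a \in S -> lk S a <= lk (restr S z (a z)) a.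
Proof.
have [k] := ubnP #|liquid S|; elim: k S z => // k IH S z; rewrite ltnS => Sk aS.
have [zl|zl] := boolP (z \in liquid S); last first.
  by rewrite (restr_frozen _ aS zl) eqxx.
have L0 : liquid S != set0 by apply/set0Pn; exists z.
set S' := restr S z (a z); set L := liquid S; set L' := liquid S'.
have aS' : a \in S' by exact: mem_restr.
have LP : 0 < 2 * #|L|%:R :> R.
  by rewrite mulr_gt0 ?ltr0n // card_gt0.
rewrite -(ler_pM2l LP) lkE //.
have subL : L' \subset L :\ z by exact: liquid_restr.
have le1 : \sum_(y in L) lk (restr S y (a y)) a <=
  \sum_(y in L) lk (restr S' y (a y)) a.
  apply: ler_sum => y yl; have [->|yz] := eqVneq y z.
    rewrite [leRHS](_ : _ = lk S' a) // (restr_frozen _ aS') ?eqxx //.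
    by apply/negP => /(subsetP subL); rewrite !inE eqxx.
  rewrite /S' restrC; apply: IH; last exact: mem_restr.
  exact: leq_trans (card_liquid_restr _ yl) _.
apply: le_trans le1 _.
have -> : \sum_(y in L) lk (restr S' y (a y)) a =
   \sum_(y in L') lk (restr S' y (a y)) a + \sum_(y in L :\: L') lk S' a.
  rewrite (big_setID L') /= (setIidPr _); last first.
    by apply: subset_trans subL _; exact: subD1set.
  congr (_ + _); apply: eq_bigr => y; rewrite inE => /andP[yL' _].
  by rewrite (restr_frozen _ aS' yL') eqxx.
have cL : (#|L :\: L'| + #|L'| = #|L|)%N.
  rewrite addnC -(cardsID L' L) (setIidPr _) //.
  by apply: subset_trans subL _; exact: subD1set.
have cL' : (#|L'| < #|L|)%N by exact: card_liquid_restr.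
have [L'0|L'0] := eqVneq L' set0.
  rewrite L'0 big_set0 add0r sumr_const -[lk _ _ *+ _]mulr_natl setD0.
  by apply: ler_wpM2r; [exact: lk_ge0 | rewrite ler_peMl ?ler1n ?ler0n].
rewrite -lkE // sumr_const -[lk _ _ *+ _]mulr_natl -mulrDl; apply: ler_wpM2r; first exact: lk_ge0.
by rewrite -/L' -!natrM -natrD ler_nat; lia.
Qed.

(** By [lkE] a liquid variable counts twice on average, and a frozen one counts once because
    restricting it changes nothing. The factor is the number of pairs of a variable in [W] and a
    value it can still take. *)
Lemma lk_sum_vars (W : seq 'I_n) S a :
  uniq W -> {subset liquid S <= W} -> a \in S ->
  \sum_(y <- W) lk (restr S y (a y)) a = (size W + #|liquid S|)%:R * lk S a.
Proof.
move=> uW subW aS.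
have cardW : #|liquid S| = count (mem (liquid S)) W.
  rewrite cardE -size_filter; apply: perm_size; apply: uniq_perm.
  - exact: enum_uniq.
  - exact: filter_uniq.
  move=> y; rewrite mem_enum mem_filter; apply/idP/andP => [yl|[]//].
  by split; last exact: subW.
rewrite (bigID (mem (liquid S))) /=.
have -> : \sum_(y <- W | y \in liquid S) lk (restr S y (a y)) a =
          \sum_(y in liquid S) lk (restr S y (a y)) a.
  rewrite -big_filter -[RHS]big_enum; apply: perm_big; apply: uniq_perm.
  - exact: filter_uniq.
  - exact: enum_uniq.
  move=> y; rewrite mem_enum mem_filter; apply/andP/idP => [[]//|yl].
  by split; last exact: subW.
have -> : \sum_(y <- W | y \notin liquid S) lk (restr S y (a y)) a =
          (size W - #|liquid S|)%:R * lk S a.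
  under eq_bigr => y yl do rewrite (restr_frozen _ aS yl) eqxx.
  rewrite big_const_seq iter_addr_0 mulr_natl -(count_predC (mem (liquid S))) cardW.
  by rewrite addKn.
have [L0|L0] := eqVneq (liquid S) set0.
  by rewrite L0 big_set0 cards0 subn0 addn0 add0r.
rewrite -lkE // -mulrDl -natrM -natrD; congr (_%:R * _).
have := count_size (mem (liquid S)) W; rewrite -cardW; clear; move: #|_| (size W) => L s; lia.
Qed.

End Likelihood.

(** * Critical clause trees *)

Section Guessing.
Variables (R : realType) (n : nat) (F : cnf n) (d : nat).
Hypothesis F3 : all (fun C : clause n => size C <= 3) F.
Local Notation T := {ffun 'I_n -> bool}.
Implicit Types (W : seq 'I_n) (rho : seq (literal n)) (a : T) (x y : 'I_n).
Local Open Scope ring_scope.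

Local Notation sols := (sols F).
Local Notation forced := (forced F d).
Local Notation refuted := (refuted F).

Definition remaining W rho :=
  uniq W && [forall y, (y \in W) == (y \notin map fst rho)].

Lemma remainingP W rho y : remaining W rho -> (y \in W) = (y \notin map fst rho).
Proof. by move=> /andP[_ /forallP/(_ y)/eqP]. Qed.

Lemma remaining_rem W rho y b :
  y \in W -> remaining W rho -> remaining (rem y W) ((y, b) :: rho).
Proof.
move=> yW Wrho; have /andP[uW _] := Wrho.
apply/andP; split; first exact: rem_uniq.
apply/forallP => z; rewrite mem_rem_uniq // !inE (remainingP z Wrho) negb_or.
by rewrite eq_sym.
Qed.

Lemma sols_cons y b rho : sols ((y, b) :: rho) = restr (sols rho) y b.
Proof. by apply/setP => a; rewrite !inE /= andbCA andbC. Qed.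

Definition lits a (B : {set 'I_n}) : seq (literal n) := [seq (y, a y) | y <- enum B].
Definition flips a (P : seq 'I_n) : seq (literal n) := [seq (y, ~~ a y) | y <- P].

Lemma mem_lits a B y b : ((y, b) \in lits a B) = (y \in B) && (b == a y).
Proof.
apply/mapP/andP => [[z zB [-> ->]]|[yB /eqP ->]]; first by rewrite -mem_enum eqxx.
by exists y => //; rewrite mem_enum.
Qed.

Lemma mem_flips a P y b : ((y, b) \in flips a P) = (y \in P) && (b == ~~ a y).
Proof.
apply/mapP/andP => [[z zB [-> ->]]|[yB /eqP ->]]; first by rewrite eqxx.
by exists y.
Qed.

Lemma lits_sub a (B B' : {set 'I_n}) : B \subset B' -> {subset lits a B <= lits a B'}.
Proof. by move=> /subsetP BB' [y b]; rewrite !mem_lits => /andP[/BB' -> ->]. Qed.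

(* The critical clause tree: a clause violated by [a] with the variables of [P]
   flipped has a literal on [P], and its other literals name the children. *)
Lemma cutp_le_refuted (q : R) a rho k W (P : seq 'I_n) x : 0 <= q <= 1 ->
    a \in sols rho -> x \notin liquid (sols rho) -> x \in P -> uniq (P ++ W) ->
    (forall y, (y \in P ++ W) = (y \notin map fst rho)) ->
  cutp q k <= (bern W (fun B => (refuted k (flips a P ++ lits a B ++ rho))%:R)).[q].
Proof.
move=> q01 aS xl; elim: k W P => [|k IH] W P xP uPW PWrho.
  by apply: bern_ge0 => // B; rewrite ler0n.
have /andP[q0 q1] := q01.
have /andP[c0 c1] := @cutp01 R q k q01.
move: (aS); rewrite inE => /andP[aF arho].
pose a' : T := [ffun y => a y (+) (y \in P)].
have a'rho : agrees a' rho.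
  apply/allP => l lrho; rewrite /a' ffunE.
  suff /negPf -> : l.1 \notin P by rewrite addbF; exact: (allP arho).
  apply/negP => lP; have := PWrho l.1.
  by rewrite mem_cat lP /= => /esym; rewrite map_f.
have : ~~ satisfies a' F.
  apply/negP => a'F; have : a' \in sols rho by rewrite inE a'F.
  have := restr_frozen (a' x) aS xl.
  rewrite /a' ffunE xP addbT; case: eqVneq => [|_ e a'S]; first by case: (a x).
  have := mem_restr x a'S; rewrite /a' ffunE xP addbT e.
  by rewrite inE.
rewrite -has_predC => /hasP[C CF /= /hasPn a'C].
have CW l : l \in C -> neg l \notin flips a P ++ rho -> l.1 \in W /\ l.2 = ~~ a l.1.
  case: l => y b lC; have := a'C _ lC; rewrite /a' ffunE /= mem_cat negb_or mem_flips.
  case: (boolP (y \in P)) => [yP|yP] /=.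
    by rewrite addbT; case: (a y) b {lC} => -[].
  rewrite addbF => ab; have {lC ab} -> : b = ~~ a y by case: (a y) b ab {lC} => -[].
  move=> yrho; split=> //; have := PWrho y; rewrite mem_cat (negPf yP) /= => ->.
  apply: contra yrho => /mapP[[z c] zrho /= yz]; subst z.
  by rewrite /neg /= negbK (eqP (allP arho _ zrho)).
(* [a] satisfies [C] through a literal that the flips on [P] falsify, which leaves at most two
   children. *)
have countC : (count (predC (fun l => neg l \in flips a P ++ rho)) C <= 2)%N.
  have /hasP[l lC /eqP al] := allP aF _ CF.
  have : has (fun l => neg l \in flips a P ++ rho) C.
    apply/hasP; exists l => //; apply/negPn/negP => /(CW _ lC)[_].
    by rewrite -al; case: (a l.1).
  rewrite has_count => h1.
  rewrite -(leq_add2l (count (fun l => neg l \in flips a P ++ rho) C)) count_predC.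
  exact: leq_trans (allP F3 _ CF) (leq_add h1 (leqnn 2)).
pose E (l : literal n) (B : {set 'I_n}) :=
  (neg l \in flips a P ++ lits a B ++ rho) || refuted k (l :: flips a P ++ lits a B ++ rho).
(* A child is closed if its variable lies in the random set, or if it does not and there is a cut
   below it. *)
set s := q + (1 - q) * cutp q k.
have s0 : 0 <= s by rewrite addr_ge0 ?mulr_ge0 ?subr_ge0.
have s1 : s <= 1.
  have : (1 - q) * cutp q k <= (1 - q) * 1 by rewrite ler_wpM2l ?subr_ge0.
  by rewrite /s; lra.
apply: (@le_trans _ _ (s ^+ count (predC (fun l => neg l \in flips a P ++ rho)) C)).
  exact: ler_wiXn2l.
apply: (@le_trans _ _ (bern W (fun B => (all (E^~ B) C)%:R)).[q]); last first.
  apply: ler_bern => // B; rewrite ler_nat; case: (boolP (all _ C)) => // CE.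
  have : refuted k.+1 (flips a P ++ lits a B ++ rho) by apply/hasP; exists C.
  by move=> /= ->.
apply: bern_all => // [l B B' BB'|l B|l lC nl].
- have sub : {subset flips a P ++ lits a B ++ rho <= flips a P ++ lits a B' ++ rho}.
    by move=> m; rewrite !mem_cat => /or3P[->|/(lits_sub BB') ->|->]; rewrite ?orbT.
  case/orP => [/sub|h]; rewrite /E; first by move=> ->.
  apply/orP; right; apply: refuted_sub h => m; rewrite !in_cons.
  by case/orP => [->|/sub ->]; rewrite ?orbT.
- by rewrite /E !mem_cat => /orP[->|->]; rewrite ?orbT.
case: (CW l lC nl); case: l lC nl => y b /= lC nl yW eb; subst b.
rewrite (bern_rem _ yW) /=.
rewrite (@eq_bern _ _ _ _ (fun=> 1)); last first.
  by move=> B; rewrite /E !mem_cat /neg /= mem_lits !inE eqxx negbK eqxx !orbT.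
rewrite bern_cst !hornerE; apply: lerD => //.
apply: ler_wpM2l; rewrite ?subr_ge0 //.
have uPW' : uniq ((y :: P) ++ rem y W).
  rewrite -(perm_uniq (_ : perm_eq (P ++ W) _)) //.
  rewrite perm_sym /= -cat1s perm_catCA perm_cat2l perm_sym; exact: perm_to_rem.
apply: le_trans (IH (rem y W) (y :: P) _ uPW' _) _.
- by rewrite in_cons xP orbT.
- move=> z; rewrite -PWrho; apply: perm_mem.
  rewrite /= -cat1s perm_catCA perm_cat2l perm_sym; exact: perm_to_rem.
apply: ler_bern => // B; rewrite ler_nat /E.
by case: (boolP (refuted k _)) => // _; rewrite orbT.
Qed.

(** For [W] the unassigned variables other than [x]: the chance that [x] is not yet forced to [a x]
    when its turn comes in a random order, if the variables before it are set as in [a]. *)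
Definition kap W rho x a : R :=
  integ (bern W (fun B => (~~ forced (lits a B ++ rho) x (a x))%:R)).

Lemma kap_consE W rho x y a :
  kap W ((y, a y) :: rho) x a =
  integ (bern W (fun B => (~~ forced (lits a (y |: B) ++ rho) x (a x))%:R)).
Proof.
congr integ; apply: eq_bern => B; congr (~~ _)%:R; apply: refuted_mem => -[z c].
rewrite !(in_cons, mem_cat) !mem_lits !inE; congr (_ || _).
rewrite xpair_eqE; case: (eqVneq z y) => [->|] //=.
by case: (c == a y) => //=; rewrite ?orbT ?andbF.
Qed.

(** This conditions on the first variable of the order, which is [x] or some [y] in [W]. *)
Lemma kap_rec W rho x a : uniq W ->
  kap W rho x a +
  \sum_(y <- W) (kap W rho x a - kap (rem y W) ((y, a y) :: rho) x a) =
  (~~ forced rho x (a x))%:R.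
Proof.
move=> uW; under eq_bigr do rewrite kap_consE.
by rewrite integ_bern // /lits enum_set0.
Qed.

Lemma kap_le W rho x y a : y \in W ->
  kap (rem y W) ((y, a y) :: rho) x a <= kap W rho x a.
Proof.
move=> yW; rewrite kap_consE /kap (bern_rem _ yW) -subr_ge0 -integB /=.
apply: integ_ge0 => q q01; rewrite !hornerE.
set f1 := (bern _ _).[q]; set f0 := (bern _ _).[q].
suff : f1 <= f0.
  move: q01 => /andP[q0 q1] le; have : 0 <= (1 - q) * (f0 - f1).
    by rewrite mulr_ge0 ?subr_ge0.
  lra.
apply: ler_bern => // B; rewrite ler_nat.
case: (boolP (forced (lits a B ++ rho) x (a x))) => //= h; last by case: (~~ _).
rewrite (_ : forced _ _ _) //; apply: refuted_sub h => m.
rewrite !(in_cons, mem_cat) => /or3P[->//|h|->]; rewrite ?orbT //.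
by rewrite (lits_sub _ h) ?orbT // subsetUr.
Qed.

Lemma kap_rate W rho x a : remaining W rho -> x \in W ->
    a \in sols rho -> x \notin liquid (sols rho) ->
  kap (rem x W) rho x a <= ppsz_rate R d.
Proof.
move=> Wrho xW aS xl; apply: integ_le_ppsz_rate => q q01.
have /andP[uW _] := Wrho.
pose g B : R := (refuted d (flips a [:: x] ++ lits a B ++ rho))%:R.
have -> : bern (rem x W) (fun B => (~~ forced (lits a B ++ rho) x (a x))%:R) =
          1%:P - bern (rem x W) g.
  rewrite -(bern_cst (rem x W)) -bernB; apply: eq_bern => B; rewrite /g /forced /=.
  by case: (refuted d _); rewrite /= ?subr0 ?subrr.
have pW : perm_eq ([:: x] ++ rem x W) W by rewrite perm_sym; exact: perm_to_rem.
rewrite hornerD hornerC hornerN lerD2l lerN2.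
apply: (cutp_le_refuted _ q01 aS xl); rewrite ?mem_head ?(perm_uniq pW) //.
by move=> y; rewrite (perm_mem pW) (remainingP y Wrho).
Qed.

End Guessing.

(** * The cost function *)

Section Cost.
Variables (R : realType) (n : nat) (F : cnf n) (d : nat).
Hypothesis F3 : all (fun C : clause n => size C <= 3) F.
Local Notation T := {ffun 'I_n -> bool}.
Implicit Types (W : seq 'I_n) (rho : seq (literal n)) (a : T) (x y : 'I_n) (b : bool).
Local Open Scope ring_scope.

Local Notation sols := (sols F).
Local Notation forced := (forced F d).
Local Notation lk := (lk R).
Local Notation kap := (kap R F d).
Local Notation sigma := (ppsz_rate R d).

Lemma big_rem_cond W y (f : 'I_n -> R) : uniq W ->
  \sum_(x <- rem y W) f x = \sum_(x <- W | x != y) f x.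
Proof. by move=> uW; rewrite rem_filter // big_filter. Qed.

Lemma remC W x y : uniq W -> rem x (rem y W) = rem y (rem x W).
Proof.
move=> uW; rewrite !rem_filter ?filter_uniq // -!filter_predI.
by apply: eq_filter => z /=; rewrite andbC.
Qed.

Lemma sum_bool_restr (S : {set T}) y (f : bool -> T -> R) :
  \sum_b \sum_(a in restr S y b) f b a = \sum_(a in S) f (a y) a.
Proof.
rewrite [RHS](partition_big (fun a : T => a y) predT) //=.
apply: eq_bigr => b _; rewrite (eq_bigl (fun a => (a \in S) && (a y == b))).
  by apply: eq_bigr => a /andP[_ /eqP ->].
by move=> a; rewrite inE.
Qed.

Lemma liquid_remaining W rho : remaining W rho -> {subset liquid (sols rho) <= W}.
Proof.
move=> Wrho y yl; rewrite (remainingP y Wrho); apply: contraL yl.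
move=> /mapP[[z c] zrho /= ->].
have agr a b : a \in restr (sols rho) z b -> b = c.
  by rewrite !inE => /andP[/andP[_ /allP/(_ _ zrho)/= /eqP ->] /eqP].
by rewrite inE; apply/negP => /andP[/set0Pn[a1 /agr e1] /set0Pn[a2 /agr]]; rewrite -e1.
Qed.

Definition frozen_cost W rho x : R :=
  \sum_(a in sols rho) lk (sols rho) a * kap (rem x W) rho x a.

Definition cost W rho x : R :=
  if x \in liquid (sols rho) then sigma else frozen_cost W rho x.

Lemma cost_le W rho x : remaining W rho -> x \in W -> sols rho != set0 ->
  cost W rho x <= sigma.
Proof.
move=> Wrho xW S0; rewrite /cost; case: ifPn => // xl.
rewrite -[leRHS]mul1r -(lk_sum R S0) mulr_suml; apply: ler_sum => a aS.
by apply: ler_wpM2l; [exact: lk_ge0 | exact: kap_rate].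
Qed.

Definition guess rho y b : R := (~~ forced rho y b)%:R.

(** Setting [y] as in [a] raises the likelihood from [l0] to [l1] ([lk_restr]) and lowers the other
    factor from [k0] to [k1] ([kap_le]). Hence [(l1 - l0) * (k0 - k1) >= 0], i.e.
    [l1 * k1 <= l1 * k0 + l0 * k1 - l0 * k0], whose sums are given by [lk_sum_vars] and
    [kap_rec]. *)
Lemma frozen_cost_drop W rho x v : remaining W rho -> x \in W ->
    sols rho != set0 -> x \notin liquid (sols rho) ->
    (forall a, a \in sols rho -> a x = v) ->
  \sum_(y <- W | y != x) \sum_b cost (rem y W) ((y, b) :: rho) x + guess rho x v
    <= (size W + #|liquid (sols rho)|)%:R * cost W rho x.
Proof.
move=> Wrho xW S0 xl av; have /andP[uW _] := Wrho; set S := sols rho.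
have -> : \sum_(y <- W | y != x) \sum_b cost (rem y W) ((y, b) :: rho) x =
  \sum_(a in S) \sum_(y <- rem x W) lk (restr S y (a y)) a *
     kap (rem y (rem x W)) ((y, a y) :: rho) x a.
  rewrite [RHS]exchange_big /= big_rem_cond //; apply: eq_bigr => y _.
  rewrite -(sum_bool_restr _ _ (fun b a => lk (restr S y b) a *
     kap (rem y (rem x W)) ((y, b) :: rho) x a)).
  apply: eq_bigr => b _; rewrite /cost sols_cons ifN; last first.
    by apply: contra xl; apply/subsetP; apply: liquid_sub; exact: restr_sub.
  by rewrite /frozen_cost sols_cons remC.
have -> : guess rho x v = \sum_(a in S) lk S a * guess rho x (a x).
  rewrite -[LHS]mul1r -(lk_sum R S0) mulr_suml; apply: eq_bigr => a aS.
  by rewrite av.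
rewrite -big_split /cost (negPf xl) /frozen_cost mulr_sumr; apply: ler_sum => a aS.
have subl := liquid_remaining Wrho.
rewrite mulrA -(lk_sum_vars R uW subl aS) (perm_big _ (perm_to_rem xW)) big_cons /=.
rewrite (restr_frozen _ aS xl) eqxx.
have uWx : uniq (rem x W) by exact: rem_uniq.
rewrite /guess -(kap_rec R F d rho x a uWx) mulrDr mulrDl mulr_suml mulr_sumr.
rewrite addrCA lerD2l -big_split /= big_seq [leRHS]big_seq.
apply: ler_sum => y yW; rewrite -subr_ge0.
set k0 := kap (rem x W) rho x a; set k1 := kap (rem y (rem x W)) _ _ _.
have k10 : k1 <= k0 by exact: kap_le.
have := lk_restr R y aS; set l0 := lk S a; set l1 := lk _ a => l10.
have : 0 <= (l1 - l0) * (k0 - k1) by rewrite mulr_ge0 ?subr_ge0.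
lra.
Qed.

Lemma sum_open (S : {set T}) a y (f : bool -> R) : a \in S ->
  \sum_(b | restr S y b != set0) f b =
  if y \in liquid S then f true + f false else f (a y).
Proof.
move=> aS; rewrite big_mkcond big_bool /=; have [yl|yl] := boolP (y \in liquid S).
  by move: yl; rewrite inE => /andP[-> ->].
rewrite !(restr_frozen _ aS yl).
have S0 : S != set0 by apply/set0Pn; exists a.
by case: (a y); rewrite /= eqxx S0 ?addr0 ?add0r.
Qed.

Lemma sum_liquid W rho : remaining W rho ->
  \sum_(x <- W) (x \in liquid (sols rho))%:R = #|liquid (sols rho)|%:R :> R.
Proof.
move=> Wrho; have /andP[uW _] := Wrho.
rewrite -natr_sum; congr _%:R.
have -> : (\sum_(x <- W) (x \in liquid (sols rho)) = count (mem (liquid (sols rho))) W)%N.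
  by rewrite -sum1_count [RHS]big_mkcond.
rewrite -size_filter cardE; apply: perm_size; apply: uniq_perm.
- exact: filter_uniq.
- exact: enum_uniq.
move=> y; rewrite mem_enum mem_filter; apply/andP/idP => [[]//|yl].
by split; last exact: (liquid_remaining Wrho).
Qed.

(** The sum is over the [M] possible pairs (variable, value). A frozen [x] is covered by
    [frozen_cost_drop]. A liquid [x] costs at most [sigma] after the [M - 2] pairs not fixing it and
    one guess for each of the other two: [(M - 2) * sigma + 2 = M * sigma + 2 * (1 - sigma)]. *)
Lemma cost_sum_drop W rho : remaining W rho -> sols rho != set0 ->
  \sum_(y <- W) \sum_(b | restr (sols rho) y b != set0)
     (\sum_(x <- rem y W) cost (rem y W) ((y, b) :: rho) x + guess rho y b)
  <= (size W + #|liquid (sols rho)|)%:R * (\sum_(x <- W) cost W rho x)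
     + 2 * (1 - sigma) * #|liquid (sols rho)|%:R.
Proof.
move=> Wrho S0; have [a aS] := set0Pn _ S0; have /andP[uW _] := Wrho.
set S := sols rho; set M := (size W + _)%:R.
have -> : \sum_(y <- W) \sum_(b | restr S y b != set0)
     (\sum_(x <- rem y W) cost (rem y W) ((y, b) :: rho) x + guess rho y b)
  = \sum_(x <- W) (\sum_(y <- W | y != x) \sum_(b | restr S y b != set0)
        cost (rem y W) ((y, b) :: rho) x
      + \sum_(b | restr S x b != set0) guess rho x b).
  under eq_bigr do rewrite big_split /=.
  rewrite !big_split /=; congr (_ + _).
  under [RHS]eq_bigr do rewrite big_mkcond /=.
  rewrite [RHS]exchange_big /=; apply: eq_bigr => y _.
  under eq_bigr do rewrite big_rem_cond //.
  rewrite exchange_big /= [LHS]big_mkcond /=; apply: eq_bigr => x _.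
  by rewrite eq_sym.
rewrite -(sum_liquid Wrho) !mulr_sumr -big_split /= big_seq [leRHS]big_seq.
apply: ler_sum => x xW; rewrite (sum_open _ _ aS) -/S.
have [xl|xl] := boolP (x \in liquid S); last first.
  rewrite mulr0 addr0.
  have xS a' : a' \in S -> a' x = a x.
    move=> a'S; have := mem_restr x a'S; rewrite (restr_frozen _ aS xl).
    by case: eqVneq => //; rewrite inE.
  apply: le_trans (frozen_cost_drop Wrho xW S0 xl xS); rewrite lerD2r.
  apply: ler_sum => y _; rewrite big_mkcond; apply: ler_sum => b _.
  case: eqVneq => //= e; rewrite /cost /frozen_cost sols_cons -/S e big_set0.
  rewrite ifN //; apply/negP; rewrite inE; case/andP => /set0Pn[a'].
  by rewrite !inE.
have -> : cost W rho x = sigma by rewrite /cost xl.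
have nf b : ~~ forced rho x b.
  have /set0Pn[a'] : restr S x (~~ b) != set0 by move: xl; rewrite inE; case: b => /andP[].
  rewrite !inE => /andP[/andP[a'F a'rho] /eqP a'x].
  by apply/negP => /(forced_sound a'F a'rho); rewrite a'x; case: b {a'x}.
rewrite /guess !nf.
apply: (@le_trans _ _ ((M - 2) * sigma + 2)); last by rewrite mulr1n; lra.
rewrite -[1%:R + 1%:R]/(2 : R) lerD2r.
have -> : (M - 2) * sigma =
    \sum_(y <- W | y != x) \sum_(b | restr S y b != set0) sigma.
  have : \sum_(y <- W) \sum_(b | restr S y b != set0) sigma = M * sigma.
    under eq_bigr do rewrite (sum_open _ (fun=> sigma) aS).
    rewrite /M natrD mulrDl -(sum_liquid Wrho) mulr_suml.
    have -> : (size W)%:R * sigma = \sum_(y <- W) sigma.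
      by rewrite big_const_seq count_predT iter_addr_0 mulr_natl.
    rewrite -big_split; apply: eq_bigr => y _ /=.
    by case: ifP => _; rewrite ?mul1r ?mul0r ?addr0.
  rewrite (perm_big _ (perm_to_rem xW)) big_cons /= (sum_open _ (fun=> sigma) aS) xl.
  by rewrite -big_rem_cond //; lra.
rewrite big_seq_cond [leRHS]big_seq_cond; apply: ler_sum => y /andP[yW yx].
apply: ler_sum => b ne; apply: cost_le; first exact: remaining_rem.
  by rewrite mem_rem_uniq // inE eq_sym yx.
by rewrite sols_cons.
Qed.

Definition value W rho : R :=
  if sols rho == set0 then 0 else expR (- (ln 2 * \sum_(x <- W) cost W rho x)).

Lemma value_ge0 W rho : 0 <= value W rho.
Proof. by rewrite /value; case: ifP => // _; exact: expR_ge0. Qed.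

Definition step_value W rho y : R :=
  if forced rho y true then value (rem y W) ((y, true) :: rho)
  else if forced rho y false then value (rem y W) ((y, false) :: rho)
  else (value (rem y W) ((y, true) :: rho) + value (rem y W) ((y, false) :: rho)) / 2.

Lemma step_value_ge0 W rho y : 0 <= step_value W rho y.
Proof.
rewrite /step_value; case: ifP => _; first exact: value_ge0.
by case: ifP => _; rewrite ?divr_ge0 ?addr_ge0 ?value_ge0.
Qed.

Lemma expR_ln2N : expR (- ln 2) = 2^-1 :> R.
Proof. by rewrite expRN lnK // posrE. Qed.

(** A value of [y] without solutions contributes 0 and is dropped. One that has to be guessed loses
    a factor 1/2 to the coin, which is the unit that [guess] adds to the exponent. *)
Lemma step_value_ge W rho y : sols rho != set0 ->
  \sum_(b | restr (sols rho) y b != set0)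
    expR (- (ln 2 * (\sum_(x <- rem y W) cost (rem y W) ((y, b) :: rho) x
                    + guess rho y b)))
  <= step_value W rho y.
Proof.
move=> S0; have [a aS] := set0Pn _ S0; set S := sols rho.
pose v b := value (rem y W) ((y, b) :: rho).
have v0 b : 0 <= v b by exact: value_ge0.
rewrite (eq_bigr (fun b => v b * (if forced rho y b then 1 else 2^-1))); last first.
  move=> b ne; rewrite /v /value sols_cons (negPf ne) mulrDr opprD expRD /guess.
  by case: (forced _ _ _); rewrite /= ?mulr0 ?oppr0 ?expR0 // mulr1 expR_ln2N.
rewrite (sum_open _ _ aS) /step_value -!/(v _); case: ifPn => yl.
  have nf b : ~~ forced rho y b.
    have /set0Pn[a'] : restr S y (~~ b) != set0 by move: yl; rewrite inE; case: b => /andP[].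
    rewrite !inE => /andP[/andP[a'F a'rho] /eqP a'x].
    by apply/negP => /(forced_sound a'F a'rho); rewrite a'x; case: b {a'x}.
  by rewrite !(negPf (nf _)); lra.
move: (aS); rewrite inE => /andP[aF arho].
have nf : ~~ forced rho y (~~ a y).
  by apply/negP => /(forced_sound aF arho); case: (a y).
have := v0 true; have := v0 false; move: nf; case: (a y) => /= /negPf ->.
  by case: ifP => _; lra.
by case: ifP => _; lra.
Qed.

(* One round of PPSZ: the potential [value] does not decrease on average when a
   variable is chosen uniformly.  The slack comes from [4 t (1 - t) <= 1] with
   [t = ln 2], as [1 - sigma <= 2 (1 - ln 2)]. *)
Lemma value_step W rho : remaining W rho ->
  (size W)%:R * value W rho <= \sum_(y <- W) step_value W rho y.
Proof.
move=> Wrho; rewrite {1}/value; case: eqVneq => [_|S0].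
  by rewrite mulr0 sumr_ge0 // => y _; exact: step_value_ge0.
apply: le_trans (ler_sum _ (fun y _ => step_value_ge W y S0)).
set C := \sum_(x <- W) cost W rho x; set S := sols rho.
set c := ln 2 : R; set L : R := #|liquid S|%:R.
set K := fun y b => \sum_(x <- rem y W) cost (rem y W) ((y, b) :: rho) x + guess rho y b.
have c0 : 0 <= c by rewrite ln_ge0 // ler1n.
have /andP[uW _] := Wrho; have [a aS] := set0Pn _ S0.
have M1 : \sum_(y <- W) \sum_(b | restr S y b != set0) (1 : R) = (size W)%:R + L.
  under eq_bigr do rewrite (sum_open _ (fun=> 1) aS).
  rewrite /L /S -(sum_liquid Wrho).
  have -> : (size W)%:R = \sum_(y <- W) (1 : R).
    by rewrite big_const_seq count_predT iter_addr_0.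
  rewrite -big_split; apply: eq_bigr => y _ /=.
  by case: ifP => _; rewrite ?addr0.
have drop : \sum_(y <- W) \sum_(b | restr S y b != set0) K y b <=
    ((size W)%:R + L) * C + 2 * (1 - sigma) * L.
  by have := cost_sum_drop Wrho S0; rewrite natrD.
(* [1 + t <= exp t], taken around the current total cost, replaces Jensen's inequality. *)
have le1 : expR (- (c * C)) * \sum_(y <- W) \sum_(b | restr S y b != set0)
    (1 + c * (C - K y b)) <=
  \sum_(y <- W) \sum_(b | restr S y b != set0) expR (- (c * K y b)).
  rewrite mulr_sumr; apply: ler_sum => y _; rewrite mulr_sumr; apply: ler_sum => b _.
  have -> : - (c * K y b) = - (c * C) + c * (C - K y b) by ring.
  by rewrite expRD ler_wpM2l ?expR_ge0 // expR_ge1Dx.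
apply: le_trans le1; rewrite mulrC ler_wpM2l ?expR_ge0 //.
have -> : \sum_(y <- W) \sum_(b | restr S y b != set0) (1 + c * (C - K y b)) =
   (1 + c * C) * ((size W)%:R + L) -
   c * \sum_(y <- W) \sum_(b | restr S y b != set0) K y b.
  rewrite -M1; set A := 1 + c * C; rewrite !mulr_sumr -sumrB; apply: eq_bigr => y _.
  by rewrite !mulr_sumr -sumrB; apply: eq_bigr => b _; rewrite /A; ring.
have := ler_wpM2l c0 drop; set X := \sum_(y <- W) _; set m := (size W)%:R => cX.
(* There are [L] more pairs than variables, and this surplus has to pay for the last term of
   [drop]. *)
suff : c * (2 * (1 - sigma) * L) <= L by lra.
rewrite mulrA -[leRHS]mul1r; apply: ler_wpM2r; first exact: ler0n.
rewrite /ppsz_rate -/c; have : 0 <= d.+1%:R^-1 :> R by rewrite invr_ge0.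
move: d.+1%:R^-1 => e e0; have := sqr_ge0 (2 * c - 1); have := mulr_ge0 c0 e0.
by rewrite expr2; lra.
Qed.

End Cost.

(** * The randomized process *)

Section Expectation.
Variables (R : realFieldType) (A : Type) (u s : bool -> A -> A) (N : nat).
Implicit Types (f g : A -> R) (st : A).
Local Open Scope ring_scope.

Definition mean (h : bool -> R) : R := (h true + h false) / 2.

Fixpoint tosses j st f : R :=
  if j is j'.+1 then mean (fun b => tosses j' (u b st) f) else f st.

Fixpoint rounds i st f : R :=
  if i is i'.+1 then tosses N st (fun st' => mean (fun b => rounds i' (s b st') f))
  else f st.

Lemma tosses_affine j st f (c e : R) :
  tosses j st (fun st => c + e * f st) = c + e * tosses j st f.
Proof. by elim: j st => [|j IH] st //=; rewrite /mean !IH; field. Qed.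

Lemma eq_tosses j st f g : f =1 g -> tosses j st f = tosses j st g.
Proof. by move=> fg; elim: j st => [|j IH] st //=; rewrite /mean !IH. Qed.

Lemma rounds_affine i st f (c e : R) :
  rounds i st (fun st => c + e * f st) = c + e * rounds i st f.
Proof.
elim: i st => [|i IH] st //=; rewrite -tosses_affine; apply: eq_tosses => st'.
by rewrite /mean !IH; field.
Qed.

Lemma eq_rounds i st f g : f =1 g -> rounds i st f = rounds i st g.
Proof.
move=> fg; elim: i st => [|i IH] st //=; apply: eq_tosses => st'.
by rewrite /mean !IH.
Qed.

Lemma eq_rounds_in (P : A -> bool) i st f g :
    (forall b st, P st -> P (u b st)) -> (forall b st, P st -> P (s b st)) ->
    P st -> (forall st, P st -> f st = g st) -> rounds i st f = rounds i st g.
Proof.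
move=> Pu Ps + fg; elim: i st => [|i IH] st Pst /=; first exact: fg.
elim: N st Pst => [|j IHj] st Pst /=; rewrite /mean; last by rewrite !IHj ?Pu.
by rewrite !IH ?Ps.
Qed.

Lemma rounds_ge0 i st f : (forall st, 0 <= f st) -> 0 <= rounds i st f.
Proof.
move=> f0; have toss0 j st0 g : (forall st, 0 <= g st) -> 0 <= tosses j st0 g.
  move=> g0; elim: j st0 => [|j IH] st0 //=.
  by rewrite /mean divr_ge0 ?addr_ge0.
elim: i st => [|i IH] st //=; apply: toss0 => st'.
by rewrite /mean divr_ge0 ?addr_ge0.
Qed.

End Expectation.

Section Ppsz.
Variables (n : nat) (F : cnf n) (d : nat).

(* Assigned literals, unassigned variables, and an index into the latter. *)
Definition pstate : Type := seq (literal n) * seq 'I_n * nat.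

(** Started at index 0, [N] tosses yield an [N]-bit number modulo [size W], read from its leading
    bit and reduced on the way. *)
Definition advance (b : bool) (st : pstate) : pstate :=
  let: (rho, W, p) := st in (rho, W, (p.*2 + b) %% size W).

Definition chosen rho y b : bool :=
  if forced F d rho y true then true
  else if forced F d rho y false then false else b.

Definition assign (b : bool) (st : pstate) : pstate :=
  let: (rho, W, p) := st in
  if drop p W is y :: W' then ((y, chosen rho y b) :: rho, take p W ++ W', 0)
  else st.

Definition solved (rho : seq (literal n)) : bool :=
  all (fun C : clause n => has (mem rho) C) F.

End Ppsz.

Section Success.
Variables (R : realType) (n : nat) (F : cnf n) (d N : nat) (delta : R).
Hypothesis F3 : all (fun C : clause n => size C <= 3) F.
Local Open Scope ring_scope.
Hypothesis delta_ge : n%:R <= delta * 2 ^+ N.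
Hypothesis delta01 : 0 <= delta <= 1.
Implicit Types (rho : seq (literal n)) (W : seq 'I_n) (f : pstate n -> R).

Local Notation advance := (@advance n).
Local Notation assign := (assign F d).
Local Notation remaining := (@remaining n).
Local Notation value := (value R F d).

Lemma tosses_advance j rho W p f : (0 < size W)%N -> (p < size W)%N ->
  tosses advance j (rho, W, p) f =
  (\sum_(v < 2 ^ j) f (rho, W, ((p * 2 ^ j + v) %% size W)%N)) / 2 ^+ j.
Proof.
move=> W0; elim: j p => [|j IH] p pW /=.
  by rewrite expn0 big_ord1 expr0 divr1 muln1 addn0 modn_small.
rewrite /mean !IH ?ltn_pmod // (_ : 2 ^ j.+1 = 2 ^ j + 2 ^ j)%N; last by rewrite expnS mul2n addnn.
rewrite big_split_ord /= exprS.
set X := \sum_(_ < _) _; set Y := \sum_(_ < _) _; set X' := \sum_(_ < _) _; set Y' := \sum_(_ < _) _.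
have -> : Y = X'.
  apply: eq_bigr => v _; congr f; congr (_, _).
  by rewrite -modnDml modnMml modnDml; congr (_ %% _)%N; lia.
have -> : X = Y'.
  apply: eq_bigr => v _; congr f; congr (_, _).
  by rewrite -modnDml modnMml modnDml; congr (_ %% _)%N; lia.
by rewrite invfM; ring.
Qed.

Lemma sum_modn_ge (m k : nat) (g : nat -> R) : (forall i, 0 <= g i) -> (0 < m)%N ->
  (k %/ m)%:R * \sum_(i < m) g i <= \sum_(v < k) g (v %% m)%N.
Proof.
move=> g0 m0; have -> : \sum_(v < k) g (v %% m)%N = \sum_(v < k %/ m * m + k %% m) g (v %% m)%N.
  by rewrite -divn_eq.
rewrite big_split_ord /=.
rewrite ler_wpDr ?sumr_ge0 //; move: (k %/ m)%N => q.
elim: q => [|q IH]; first by rewrite mul0n mul0r big_ord0.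
rewrite mulSn addnC big_split_ord /= -natr1 mulrDl mul1r; apply: lerD => //.
by apply: ler_sum => i _; rewrite modnMDl modn_small.
Qed.

(** With [m = size W], every index is reached by at least [2^N %/ m] bit strings, and [m * (2^N %/
    m) >= 2^N - m >= (1 - delta) * 2^N]. *)
Lemma tosses_uniform rho W f : (0 < size W <= n)%N -> (forall st, 0 <= f st) ->
  (1 - delta) / (size W)%:R * \sum_(p < size W) f (rho, W, p : nat) <=
  tosses advance N (rho, W, 0%N) f.
Proof.
move=> /andP[W0 Wn] f0; rewrite tosses_advance //.
under [X in _ <= X / _]eq_bigr do rewrite mul0n add0n.
have m0 : 0 < (size W)%:R :> R by rewrite ltr0n.
have p0 : 0 < 2 ^+ N :> R by rewrite exprn_gt0.
rewrite ler_pdivlMr //.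
apply: le_trans (sum_modn_ge _ (fun i => f0 (rho, W, i)) W0).
rewrite mulrAC; apply: ler_wpM2r; first exact: sumr_ge0.
rewrite mulrAC ler_pdivrMr //.
have : ((2 ^ N)%:R : R) <= ((2 ^ N %/ size W) * size W + size W)%:R.
  by rewrite ler_nat {1}(divn_eq (2 ^ N) (size W)) leq_add2l ltnW // ltn_pmod.
rewrite natrD natrM natrX.
have : (size W)%:R <= n%:R :> R by rewrite ler_nat.
have := delta_ge; lra.
Qed.

Lemma solved_all rho : remaining [::] rho -> sols F rho != set0 -> solved F rho.
Proof.
move=> rho0 /set0Pn[a]; rewrite inE => /andP[/allP aF arho].
apply/allP => C /aF /hasP[[y b] lC /= /eqP ab]; apply/hasP; exists (y, b) => //.
have := remainingP y rho0; rewrite in_nil => /esym/negbFE/mapP[[z c] zrho /= yz].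
by have /eqP := allP arho _ zrho; rewrite /= -yz ab => ->; rewrite yz.
Qed.

Lemma remaining_size W rho : remaining W rho -> (size W <= n)%N.
Proof. by move=> /andP[uW _]; rewrite -[leqRHS]card_ord -(card_uniqP uW) max_card. Qed.

(** [value_step] is iterated, each choice of a variable losing a factor [1 - delta]. Rounds after
    the last variable are idle, so the clock may exceed the number of variables. *)
Lemma rounds_ge i W rho : remaining W rho -> (size W <= i)%N ->
  (1 - delta) ^+ size W * value W rho <=
  rounds advance assign N i (rho, W, 0%N) (fun st => (solved F st.1.1)%:R).
Proof.
have d1 : 0 <= 1 - delta by case/andP: delta01 => _; rewrite subr_ge0.
have idle k rho' p : remaining [::] rho' ->
    value [::] rho' <= rounds advance assign N k (rho', [::], p) (fun st => (solved F st.1.1)%:R).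
  move=> rho0; elim: k p => [|k IH] p /=.
    rewrite /value; case: eqVneq => S0; first exact: ler0n.
    by rewrite solved_all // big_nil mulr0 oppr0 expR0.
  have {}IH q : value [::] rho' <= mean (fun b => rounds advance assign N k
      (assign b (rho', [::], q)) (fun st => (solved F st.1.1)%:R)).
    by rewrite /mean ler_pdivlMr // mulrDr mulr1 lerD // IH.
  elim: {1}N p => [|j IHj] p //=; first exact: IH.
  by rewrite /mean ler_pdivlMr // mulrDr mulr1 lerD.
elim: i W rho => [|i IH] W rho Wrho Wi; have [W0|W0] := posnP (size W).
- by move: (size0nil W0) Wrho => -> rho0; rewrite expr0 mul1r idle.
- by move: (leq_trans W0 Wi).
- by move: (size0nil W0) Wrho => -> rho0; rewrite expr0 mul1r idle.
have /andP[uW _] := Wrho.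
have Wn := remaining_size Wrho.
rewrite /=; apply: le_trans (tosses_uniform _ _ _); rewrite ?W0 //; last first.
  by move=> st; rewrite /mean divr_ge0 ?addr_ge0 ?rounds_ge0.
have m0 : 0 < (size W)%:R :> R by rewrite ltr0n.
apply: (@le_trans _ _ ((1 - delta) / (size W)%:R *
   ((1 - delta) ^+ (size W).-1 * \sum_(y <- W) step_value R F d W rho y))).
  rewrite -[in leLHS](prednK W0) exprS -!mulrA; apply: ler_wpM2l => //.
  rewrite mulrCA; apply: ler_wpM2l; first exact: exprn_ge0.
  by rewrite ler_pdivlMl // value_step.
apply: ler_wpM2l; first by rewrite divr_ge0.
have [y0 _] : exists y0, y0 \in W.
  by case: {+}W W0 => // y0 W' _; exists y0; exact: mem_head.
rewrite (big_nth y0) big_mkord mulr_sumr; apply: ler_sum => p _.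
set y := nth y0 W p.
have yW : y \in W by exact: mem_nth.
have eW : take p W ++ drop p.+1 W = rem y W by rewrite remE index_uniq.
have bound b : (1 - delta) ^+ (size W).-1 * value (rem y W) ((y, chosen F d rho y b) :: rho)
    <= rounds advance assign N i (assign b (rho, W, p : nat)) (fun st => (solved F st.1.1)%:R).
  rewrite /assign (drop_nth y0) // -/y eW -(size_rem yW).
  apply: IH; first exact: remaining_rem.
  by rewrite size_rem // -ltnS prednK.
apply: (@le_trans _ _ (mean (fun b => (1 - delta) ^+ (size W).-1 *
    value (rem y W) ((y, chosen F d rho y b) :: rho)))).
  rewrite /mean /step_value /chosen -mulrDr -mulrA; apply: ler_wpM2l; first exact: exprn_ge0.
  by case: ifP => _; [|case: ifP => _]; lra.
by rewrite /mean ler_pM2r ?invr_gt0 // lerD.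
Qed.

End Success.

(** * Success probability of one run *)

Section Constants.
Variable R : realType.
Local Open Scope ring_scope.

Lemma exp_series_le (x : R) m : 0 <= x -> \sum_(0 <= i < m) x ^+ i / i`!%:R <= expR x.
Proof.
move=> x0; apply: (@nondecreasing_cvgn_le R (series (exp_coeff x))).
  apply: nondecreasing_series => k _ _.
  by rewrite /exp_coeff /= divr_ge0 ?exprn_ge0.
exact: is_cvg_series_exp_coeff.
Qed.

(** Nine terms of the exponential series at [253 / 365] already exceed 2. *)
Lemma ln2_lt : ln 2 < 253 / 365 :> R.
Proof.
rewrite -ltr_expR lnK ?posrE //.
apply: lt_le_trans (@exp_series_le (253 / 365) 9 _); last by lra.
rewrite !big_nat_recr //= big_nil !factS fact0.
lra.
Qed.

Lemma archi_inv (e : R) : 0 < e -> exists m, m.+1%:R^-1 <= e.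
Proof.
move=> e0; exists (Num.bound e^-1).
rewrite invf_ple ?posrE // ?ltr0n //; apply: ltW.
apply: lt_le_trans (archi_boundP _) _; first by rewrite invr_ge0 ltW.
by rewrite ler_nat.
Qed.

(** With [h = 253 / 365 - ln 2], the limit rate is [141 / 365 - 2 h]. One [h] is spent on the depth
    through [1 / (d + 1) <= h], the other on the bias through [1 - 2 ^- k >= exp (- h ln 2)]. *)
Lemma params_exist : exists d k : nat,
  expR (- (ln 2 * (141 / 365))) <= (1 - 2 ^- k) * expR (- (ln 2 * ppsz_rate R d)).
Proof.
have l0 : 0 < ln 2 :> R by rewrite ln_gt0 // ltr1n.
have := ln2_lt => l1; set l := ln 2 : R in l0 l1 *.
have [d dP] := @archi_inv (253 / 365 - l) ltac:(lra).
set h := 253 / 365 - l in dP; have h0 : 0 < h by rewrite /h; lra.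
have e1 : expR (- (l * h)) < 1.
  by rewrite -[ltRHS]expR0 ltr_expR oppr_lt0 mulr_gt0.
have [k kP] := @archi_inv (1 - expR (- (l * h))) ltac:(lra).
exists d, k; apply: (@le_trans _ _ (expR (- (l * h)) * expR (- (l * ppsz_rate R d)))).
  rewrite -expRD ler_expR /ppsz_rate -/l.
  have : 0 <= l * (h - d.+1%:R^-1) by rewrite mulr_ge0 ?subr_ge0 // ltW.
  by rewrite /h; move: d.+1%:R^-1 => e; lra.
apply: ler_wpM2r; first exact: expR_ge0.
have : 2 ^- k <= k.+1%:R^-1 :> R.
  by rewrite lef_pV2 ?posrE ?ltr0n ?exprn_gt0 // -natrX ler_nat ltn_expl.
by move=> /le_trans/(_ kP); rewrite lerBrDr addrC -lerBrDr.
Qed.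

End Constants.

Section SuccessBound.
Variables (R : realType) (n : nat) (F : cnf n) (d N : nat) (delta : R).
Hypothesis F3 : all (fun C : clause n => size C <= 3) F.
Local Open Scope ring_scope.

Lemma success_ge (W : seq 'I_n) i : uniq W -> (forall x, x \in W) -> (n <= i)%N -> satisfiable F ->
    n%:R <= delta * 2 ^+ N -> 0 <= delta <= 1 ->
  ((1 - delta) * expR (- (ln 2 * ppsz_rate R d))) ^+ n <=
  rounds (@advance n) (assign F d) N i ([::], W, 0%N) (fun st => (solved F st.1.1)%:R).
Proof.
move=> uW allW ni [a aF] dN d01.
have W0 : @remaining n W [::] by rewrite /remaining uW; apply/forallP => x; rewrite allW.
have sW : size W = n.
  rewrite -[RHS]card_ord -(card_uniqP uW); apply: eq_card => x.
  by rewrite allW.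
have S0 : sols F [::] != set0 by apply/set0Pn; exists a; rewrite inE aF.
have := @rounds_ge R n F d N delta F3 dN d01 i W [::] W0.
rewrite sW => /(_ ni); apply: le_trans; rewrite exprMn; apply: ler_wpM2l.
  by rewrite exprn_ge0 // subr_ge0; case/andP: d01.
rewrite /value (negPf S0) -expRM_natl ler_expR mulrN lerN2 mulrCA.
rewrite ler_wpM2l ?ln_ge0 ?ler1n //.
have -> : n%:R * ppsz_rate R d = \sum_(x <- W) ppsz_rate R d.
  by rewrite big_const_seq count_predT iter_addr_0 sW mulr_natl.
by apply: ler_sum => x _; apply: cost_le.
Qed.

End SuccessBound.

(** * A clocked functional language *)

Fixpoint spine (t : tree) : nat := if t is Node _ r then (spine r).+1 else 0.

(** Each step consumes a coin, used or not, so a deterministic stretch is one with the same outcome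
    for all coin strings. *)
Definition reaches (c c' : config) (k : nat) : Prop :=
  forall r : seq bool, size r = k -> foldl step c r = c'.

Definition runs (c c' : config) (K : nat) : Prop := exists2 k, k <= K & reaches c c' k.

Lemma runs_refl c : runs c c 0.
Proof. by exists 0 => // -[]. Qed.

Lemma runs_trans c c1 c2 K1 K2 : runs c c1 K1 -> runs c1 c2 K2 -> runs c c2 (K1 + K2).
Proof.
move=> [k1 le1 h1] [k2 le2 h2]; exists (k1 + k2); first exact: leq_add.
move=> r sr; rewrite -(cat_take_drop k1 r) foldl_cat h1 ?h2 //.
  by rewrite size_drop sr addKn.
by rewrite size_takel // sr leq_addr.
Qed.

Lemma runs_step c c' K : (forall b, runs (step c b) c' K) ->
  (forall b, step c b = step c true) -> runs c c' K.+1.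
Proof.
move=> h e; have [k le hk] := h true; exists k.+1 => // -[|b r] //= [sr].
by rewrite e hk.
Qed.

Lemma runs_le c c' K K' : K <= K' -> runs c c' K -> runs c c' K'.
Proof. by move=> le [k lk h]; exists k => //; exact: leq_trans le. Qed.

Lemma runs_assign x e ks s c K :
  runs (ks, upd s x (eval s e)) c K -> runs (Assign x e :: ks, s) c K.+1.
Proof. by move=> h; apply: runs_step. Qed.

Lemma runs_seq p q ks s c K :
  runs (p :: q :: ks, s) c K -> runs (Seq p q :: ks, s) c K.+1.
Proof. by move=> h; apply: runs_step. Qed.

Lemma runs_if e p q ks s c K :
  runs ((if is_leaf (eval s e) then q else p) :: ks, s) c K ->
  runs (If e p q :: ks, s) c K.+1.
Proof. by move=> h; apply: runs_step. Qed.

Lemma runs_while e p ks s c K :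
  runs (if is_leaf (eval s e) then (ks, s) else (p :: While e p :: ks, s)) c K ->
  runs (While e p :: ks, s) c K.+1.
Proof. by move=> h; apply: runs_step. Qed.

(* A language of functions on trees whose only iteration is the repetition
   [FFor], as many times as the clock register is long: the running time then
   depends on the clock only and is polynomial in it. *)
Inductive fn : Type :=
  | FExp of expr
  | FComp of fn & fn
  | FPair of fn & fn
  | FIf of fn & fn & fn
  | FFor of fn.

Fixpoint fval (N : nat) (f : fn) (x : tree) : tree :=
  match f with
  | FExp e => eval (fun=> x) e
  | FComp g f => fval N g (fval N f x)
  | FPair f g => Node (fval N f x) (fval N g x)
  | FIf c f g => if is_leaf (fval N c x) then fval N g x else fval N f x
  | FFor f => iter N (fval N f) x
  end.

Fixpoint rename (i : nat) (e : expr) : expr :=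
  match e with
  | EVar _ => EVar i
  | ELeaf => ELeaf
  | ENode e1 e2 => ENode (rename i e1) (rename i e2)
  | EHd e => EHd (rename i e)
  | ETl e => ETl (rename i e)
  end.

Lemma eval_rename s i e : eval s (rename i e) = eval (fun=> s i) e.
Proof. by elim: e => //= [e1 -> e2 ->|e ->|e ->]. Qed.

(* [compile i f] works in place on register [i] and uses the registers above
   [i] as scratch space; register 1 is the clock. *)
Fixpoint compile (i : nat) (f : fn) : prog :=
  match f with
  | FExp e => Assign i (rename i e)
  | FComp g f => Seq (compile i f) (compile i g)
  | FPair f g =>
      Seq (Assign i.+1 (EVar i)) (Seq (compile i.+1 f)
      (Seq (Assign i.+2 (EVar i)) (Seq (compile i.+2 g)
      (Assign i (ENode (EVar i.+1) (EVar i.+2))))))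
  | FIf c f g =>
      Seq (Assign i.+1 (EVar i)) (Seq (compile i.+1 c)
      (If (EVar i.+1) (compile i f) (compile i g)))
  | FFor f =>
      Seq (Assign i.+1 (EVar i)) (Seq (Assign i (EVar 1))
      (Seq (While (EVar i) (Seq (compile i.+1 f) (Assign i (ETl (EVar i)))))
      (Assign i (EVar i.+1))))
  end.

(** A conditional is charged for both branches, which makes the bound independent of the data. *)
Fixpoint fcost (N : nat) (f : fn) : nat :=
  match f with
  | FExp _ => 1
  | FComp g f => fcost N f + fcost N g + 1
  | FPair f g => fcost N f + fcost N g + 7
  | FIf c f g => fcost N c + (fcost N f + fcost N g) + 4
  | FFor f => N * (fcost N f + 3) + 7
  end.

Lemma updE s x v : upd s x v x = v.
Proof. by rewrite /upd eqxx. Qed.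

Lemma updN s x v y : y != x -> upd s x v y = s y.
Proof. by rewrite /upd => /negPf ->. Qed.

Lemma upd_lt s x v y : y < x -> upd s x v y = s y.
Proof. by move=> lt; rewrite updN // neq_ltn lt. Qed.

(** Registers below [i] survive. This protects the clock, and also the saved copies and loop
    counters while subprograms run in higher registers. *)
Lemma compile_runs N f i s ks : 1 < i -> spine (s 1) = N ->
  exists s', [/\ runs (compile i f :: ks, s) (ks, s') (fcost N f),
    s' i = fval N f (s i) & forall j, j < i -> s' j = s j].
Proof.
elim: f i s ks => [e|g IHg f IHf|f IHf g IHg|c IHc f IHf g IHg|f IHf] i s ks i1 sN /=.
- exists (upd s i (eval s (rename i e))); split.
  + by apply: runs_assign; exact: runs_refl.
  + by rewrite updE eval_rename.
  + by move=> j ji; rewrite upd_lt.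
- have [s1 [r1 v1 p1]] := IHf i s (compile i g :: ks) i1 sN.
  have [|s2 [r2 v2 p2]] := IHg i s1 ks i1; first by rewrite p1.
  exists s2; split; last by move=> j ji; rewrite p2 // p1.
    by rewrite addn1; apply: runs_seq; exact: runs_trans r1 r2.
  by rewrite v2 v1.
- set s0 := upd s i.+1 (s i); pose k3 := Assign i (ENode (EVar i.+1) (EVar i.+2)).
  pose k2 := Seq (Assign i.+2 (EVar i)) (Seq (compile i.+2 g) k3).
  have [|s1 [r1 v1 p1]] := IHf i.+1 s0 (k2 :: ks) (ltnW i1).
    by rewrite /s0 upd_lt // ltnW.
  set s1' := upd s1 i.+2 (s1 i).
  have [|s2 [r2 v2 p2]] := IHg i.+2 s1' (k3 :: ks) (ltnW (ltnW i1)).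
    have h1 : 1 < i.+1 := leqW i1.
    by rewrite /s1' upd_lt // p1 // /s0 upd_lt.
  exists (upd s2 i (Node (s2 i.+1) (s2 i.+2))); split.
  + rewrite (_ : _ + 7 = (fcost N f + (fcost N g + 1).+3).+3); last by lia.
    apply: runs_seq; apply: runs_assign; apply: runs_seq.
    apply: runs_trans r1 _.
    apply: runs_seq; apply: runs_assign; apply: runs_seq.
    apply: runs_trans r2 _.
    by apply: runs_assign; exact: runs_refl.
  + rewrite updE v2 p2 // /s1' updE upd_lt // v1 /s0 updE p1 // /s0.
    by rewrite upd_lt.
  + move=> j ji; rewrite upd_lt // p2 ?(ltn_trans ji) // /s1' upd_lt ?(ltn_trans ji) //.
    by rewrite p1 ?(ltn_trans ji) // /s0 upd_lt ?(ltn_trans ji).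
- set s0 := upd s i.+1 (s i); pose k2 := If (EVar i.+1) (compile i f) (compile i g).
  have [|s1 [r1 v1 p1]] := IHc i.+1 s0 (k2 :: ks) (ltnW i1).
    by rewrite /s0 upd_lt // ltnW.
  have e1 : s1 i.+1 = fval N c (s i) by rewrite v1 /s0 updE.
  have e2 j : j <= i -> s1 j = s j by move=> ji; rewrite p1 // /s0 upd_lt.
  have sN1 : spine (s1 1) = N by rewrite e2 // ltnW.
  have [sf [rf vf pf]] := IHf i s1 ks i1 sN1.
  have [sg [rg vg pg]] := IHg i s1 ks i1 sN1.
  exists (if is_leaf (fval N c (s i)) then sg else sf); split.
  + rewrite (_ : _ + 4 = (fcost N c + (fcost N f + fcost N g).+1).+3); last by lia.
    apply: runs_seq; apply: runs_assign; apply: runs_seq.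
    apply: runs_trans r1 _; apply: runs_if; rewrite /= e1.
    by case: ifP => _; [apply: runs_le rg | apply: runs_le rf]; lia.
  + by case: ifP => _; rewrite ?vf ?vg e2.
  + by move=> j ji; case: ifP => _; rewrite ?pf ?pg ?e2 // ltnW.
- set s0 := upd s i.+1 (s i); set s1 := upd s0 i (s0 1).
  pose w := While (EVar i) (Seq (compile i.+1 f) (Assign i (ETl (EVar i)))).
  pose k3 := Assign i (EVar i.+1).
  have loop m s2 : spine (s2 i) = m -> spine (s2 1) = N ->
      exists s', [/\ runs (w :: k3 :: ks, s2) (k3 :: ks, s') (m * (fcost N f + 3)).+1,
        s' i.+1 = iter m (fval N f) (s2 i.+1) & forall j, j < i -> s' j = s2 j].
    elim: m s2 => [|m IHm] s2 sm sN2.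
      exists s2; split=> //; apply: runs_while.
      by move: sm; rewrite /=; case: (s2 i) => //= _; exact: runs_refl.
    have [s3 [r3 v3 p3]] := IHf i.+1 s2 (Assign i (ETl (EVar i)) :: w :: k3 :: ks)
      (ltnW i1) sN2.
    set s4 := upd s3 i (tl (s3 i)).
    have [| |s5 [r5 v5 p5]] := IHm s4.
    + rewrite /s4 updE p3 //; move: sm; case: (s2 i) => //= _ r [].
      by [].
    + by rewrite /s4 upd_lt // p3 // ltnW.
    exists s5; split.
    + rewrite (_ : _.+1 = (fcost N f + (m * (fcost N f + 3)).+2).+2); last by lia.
      apply: runs_while; rewrite /=; move: sm; case: (s2 i) => //= _ _ _.
      apply: runs_seq; apply: runs_trans r3 _.
      by apply: runs_assign.
    + rewrite v5 /s4 updN ?v3 -?iterSr //.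
      by rewrite neq_ltn ltnS leqnn orbT.
    + by move=> j ji; rewrite p5 // /s4 upd_lt // p3 // ltnW.
  have s11 : s1 1 = s 1.
    by rewrite /s1 upd_lt // /s0 upd_lt // ltnW.
  have [| |s2 [r2 v2 p2]] := loop N s1; rewrite ?s11 //.
    by rewrite /s1 updE /s0 upd_lt // ltnW.
  exists (upd s2 i (s2 i.+1)); split.
  + rewrite (_ : _ + 7 = ((N * (fcost N f + 3)).+1 + 1).+1.+4); last by lia.
    apply: runs_seq; apply: runs_assign; apply: runs_seq; apply: runs_assign.
    apply: runs_seq; apply: runs_trans r2 _.
    by apply: runs_assign; exact: runs_refl.
  + rewrite updE v2 /s1 updN; last by rewrite neq_ltn ltnS leqnn orbT.
    by rewrite /s0 updE.
  + by move=> j ji; rewrite upd_lt // p2 // /s1 upd_lt // /s0 upd_lt // ltnW.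
Qed.

Definition poly_bounded (f : nat -> nat) : Prop :=
  exists C e, forall N, f N <= C * N.+1 ^ e.

Lemma poly_bounded_cst c : poly_bounded (fun=> c).
Proof. by exists c, 0 => N; rewrite expn0 muln1. Qed.

Lemma poly_bounded_id : poly_bounded id.
Proof. by exists 1, 1 => N; rewrite mul1n expn1. Qed.

Lemma poly_bounded_add f g : poly_bounded f -> poly_bounded g ->
  poly_bounded (fun N => f N + g N).
Proof.
move=> [C [e h]] [C' [e' h']]; exists (C + C'), (e + e') => N.
rewrite mulnDl; apply: leq_add.
  by apply: leq_trans (h N) _; rewrite leq_mul2l leq_pexp2l ?leq_addr ?orbT.
by apply: leq_trans (h' N) _; rewrite leq_mul2l leq_pexp2l ?leq_addl ?orbT.
Qed.

Lemma poly_bounded_mul f g : poly_bounded f -> poly_bounded g ->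
  poly_bounded (fun N => f N * g N).
Proof.
move=> [C [e h]] [C' [e' h']]; exists (C * C'), (e + e') => N.
by rewrite expnD mulnACA leq_mul.
Qed.

Lemma poly_bounded_fcost f : poly_bounded (fcost^~ f).
Proof.
elim: f => [e|g IHg f IHf|f IHf g IHg|c IHc f IHf g IHg|f IHf] /=;
  repeat (apply: poly_bounded_add || apply: poly_bounded_mul);
  by [exact: poly_bounded_cst | exact: poly_bounded_id | ].
Qed.

(** * Probabilistic execution *)

Section Probability.
Variable R : realFieldType.
Local Open Scope ring_scope.
Implicit Types (c : config) (A : config -> bool) (v : R).

Fixpoint prob A t c : R :=
  if t is t'.+1 then mean (fun b => prob A t' (step c b)) else (A c)%:R.

Lemma prob_card A t c :
  prob A t c = #|[set r : t.-tuple bool | A (foldl step c r)]|%:R / 2 ^+ t.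
Proof.
elim: t c => [|t IH] c /=.
  rewrite expr0 divr1; congr _%:R; apply/esym.
  have [Ac|nAc] := boolP (A c).
    rewrite (_ : [set _ | _] = [set: 0.-tuple bool]) ?cardsT ?card_tuple //.
    by apply/setP => r; rewrite !inE tuple0 /= Ac.
  by apply/eqP; rewrite cards_eq0; apply/eqP/setP => r; rewrite !inE tuple0 (negPf nAc).
pose S b := [set r : t.-tuple bool | A (foldl step (step c b) r)].
have -> : #|[set r : t.+1.-tuple bool | A (foldl step c r)]| = (#|S true| + #|S false|)%N.
  have inj b : injective (fun r : t.-tuple bool => [tuple of b :: r]).
    by move=> r r' [] /val_inj.
  rewrite -(card_imset (S true) (inj true)) -(card_imset (S false) (inj false)).
  rewrite -cardsUI (_ : _ :&: _ = set0) ?cards0 ?addn0; last first.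
    apply/setP => r; rewrite !inE; apply/negP => /andP[/imsetP[r1 _ ->] /imsetP[r2 _]].
    by case/(congr1 val).
  apply: eq_card => r; rewrite !inE; case/tupleP: r => b r /=.
  apply/idP/orP.
    by case: b => h; [left|right]; apply/imsetP; exists r => //; rewrite inE.
  by case=> /imsetP[r']; rewrite inE => h /(congr1 val) /= [-> ->].
rewrite /mean !IH natrD exprS invfM.
by rewrite -mulrDl mulrAC mulrA.
Qed.

(** A bound that holds from time [T] on can be propagated backwards through a program, like a
    weakest precondition. Lower bounds suffice: certain halting and certain rejection are events of
    probability at least 1. *)
Definition prob_ge A v T c : Prop := forall t, (T <= t)%N -> v <= prob A t c.

Lemma prob_ge_runs A v T c c' K : runs c c' K ->
  prob_ge A v T c' -> prob_ge A v (K + T)%N c.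
Proof.
move=> [k kK h] hv t le.
have -> : prob A t c = prob A (t - k) c'.
  have {}le : (k <= t)%N by lia.
  rewrite -{1}(subnKC le); move: (t - k)%N => j {le hv kK}.
  elim: k c h => [|k IH] c h; first by rewrite add0n -(h [::]).
  rewrite addSn /= /mean !IH; first by field.
    by move=> r sr; rewrite -(h (false :: r)) //= sr.
  by move=> r sr; rewrite -(h (true :: r)) //= sr.
by apply: hv; lia.
Qed.

Lemma prob_ge_le A v v' T T' c : v' <= v -> (T <= T')%N ->
  prob_ge A v T c -> prob_ge A v' T' c.
Proof. by move=> vv TT h t le; apply: le_trans vv (h t (leq_trans TT le)). Qed.

Lemma prob_ge_halted A c v T : halted c -> v <= (A c)%:R -> prob_ge A v T c.
Proof.
case: c => [[|//] s] _ h t _; elim: t => [|t IH] //=.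
by rewrite /mean ler_pdivlMr // mulrDr mulr1 lerD.
Qed.

Lemma prob_ge_toss A x ks s (v : bool -> R) T :
  (forall b, prob_ge A (v b) T (ks, upd s x (bool_tree b))) ->
  prob_ge A (mean v) T.+1 (Toss x :: ks, s).
Proof.
move=> h [|t] //; rewrite ltnS => le.
by rewrite /= /mean ler_pM2r ?invr_gt0 // lerD // h.
Qed.

End Probability.

Section Scheme.
Variables (ini shf asg chk : fn) (k0 : nat).

(* Registers: 0 input, then answer; 1 clock; 2 copy of the input; 3 length of the
   list put on the stack; 4 stack; 5 temporary; 6 and 7 loop counters; 8 coin;
   9 state. *)
Definition round_prog : prog :=
  Seq (Assign 7 (EVar 1))
  (Seq (While (EVar 7)
     (Seq (Toss 8) (Seq (Assign 9 (ENode (EVar 8) (EVar 9)))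
       (Seq (compile 9 shf) (Assign 7 (ETl (EVar 7)))))))
  (Seq (Toss 8) (Seq (Assign 9 (ENode (EVar 8) (EVar 9)))
       (Seq (compile 9 asg) (Assign 6 (ETl (EVar 6))))))).

Definition body_prog : prog :=
  Seq (Assign 9 (EVar 2)) (Seq (compile 9 ini) (Seq (Assign 6 (EVar 1))
  (Seq (While (EVar 6) round_prog) (Seq (compile 9 chk)
  (If (EVar 9) (Assign 0 (ENode ELeaf ELeaf)) (Assign 8 ELeaf)))))).

(* A list of length [m] on the stack stands for [2 ^ m] executions of the body. *)
Definition loop_prog : prog :=
  While (EVar 4)
    (Seq (Assign 5 (EHd (EVar 4))) (Seq (Assign 4 (ETl (EVar 4)))
    (If (EVar 5)
      (Assign 4 (ENode (ETl (EVar 5)) (ENode (ETl (EVar 5)) (EVar 4))))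
      body_prog))).

(** The inner loop divides the unary [n] by 365, rounding up because [tl Leaf = Leaf], and builds
    141 nodes per block. *)
Definition main_prog : prog :=
  Seq (Assign 1 (iter k0 (ENode ELeaf) (EHd (EVar 0))))
  (Seq (Assign 2 (EVar 0)) (Seq (Assign 0 ELeaf)
  (Seq (Assign 5 (EHd (EVar 2)))
  (Seq (While (EVar 5)
     (Seq (Assign 3 (iter 141 (ENode ELeaf) (EVar 3)))
          (Assign 5 (iter 365 ETl (EVar 5)))))
  (Seq (Assign 4 (ENode (EVar 3) ELeaf)) loop_prog))))).

Definition toss_cost N := fcost N shf + 7.
Definition round_cost N := N * toss_cost N + fcost N asg + 12.
Definition body_cost N := fcost N ini + fcost N chk + N * round_cost N + 10.

Section Run.
Variables (R : realFieldType) (St : Type) (enc : St -> tree) (inv : St -> bool).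
Variables (u a : bool -> St -> St) (check : St -> bool) (st0 : St) (x : tree) (N : nat).
Local Open Scope ring_scope.

Hypothesis ini_ok : fval N ini x = enc st0.
Hypothesis inv0 : inv st0.
Hypothesis shf_ok : forall b st, inv st ->
  fval N shf (Node (bool_tree b) (enc st)) = enc (u b st).
Hypothesis inv_u : forall b st, inv st -> inv (u b st).
Hypothesis asg_ok : forall b st, inv st ->
  fval N asg (Node (bool_tree b) (enc st)) = enc (a b st).
Hypothesis inv_a : forall b st, inv st -> inv (a b st).
Hypothesis chk_ok : forall st, inv st -> is_leaf (fval N chk (enc st)) = ~~ check st.

Variable A : config -> bool.

Definition answer (s : store) := ~~ is_leaf (s 0%N).

(* The registers surviving a round. *)
Definition same (s s' : store) :=
  [/\ s' 0%N = s 0%N, s' 1%N = s 1%N, s' 2%N = s 2%N & s' 4%N = s 4%N].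

Lemma same_trans s s1 s2 : same s s1 -> same s1 s2 -> same s s2.
Proof. by case=> ? ? ? ? [? ? ? ?]; split; congruence. Qed.

Lemma tosses_run (f : St -> R) ks T j s st :
    spine (s 1%N) = N -> spine (s 7) = j -> s 9 = enc st -> inv st ->
    (forall s' st', same s s' -> s' 6 = s 6 -> s' 9 = enc st' -> inv st' ->
       prob_ge A (f st') T (ks, s')) ->
  prob_ge A (tosses u j st f) (j * toss_cost N + 1 + T)%N
   (While (EVar 7)
     (Seq (Toss 8) (Seq (Assign 9 (ENode (EVar 8) (EVar 9)))
       (Seq (compile 9 shf) (Assign 7 (ETl (EVar 7)))))) :: ks, s).
Proof.
set w := While _ _ => sN; elim: j s st sN => [|j IH] s st sN sj se ist h.
  apply: prob_ge_runs (_ : runs _ (ks, s) 1) _; last exact: h.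
  by apply: runs_while => /=; move: sj; case: (s 7) => //= _; exact: runs_refl.
pose p1 := Seq (Assign 9 (ENode (EVar 8) (EVar 9))) (Seq (compile 9 shf) (Assign 7 (ETl (EVar 7)))).
have -> : (j.+1 * toss_cost N + 1 + T = 2 + (fcost N shf + 4 + (j * toss_cost N + 1 + T)).+1)%N.
  by rewrite /toss_cost; lia.
apply: (@prob_ge_runs _ _ _ _ _ (Toss 8 :: p1 :: w :: ks, s)).
  apply: runs_while => /=; move: sj; case: (s 7) => //= _ _ _.
  by apply: runs_seq; exact: runs_refl.
apply: prob_ge_toss => b.
set s1 := upd s 8 _; set s2 := upd s1 9 (Node (s1 8) (s1 9)).
have [|//|s3 [r3 v3 e3]] := @compile_runs N shf 9 s2 (Assign 7 (ETl (EVar 7)) :: w :: ks).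
  by [].
set s4 := upd s3 7 (tl (s3 7)).
have s4E i : (i < 8)%N -> i != 7 -> s4 i = s i.
  move=> i8 i7; rewrite /s4 updN // e3 ?(ltn_trans i8) // /s2 upd_lt ?(ltn_trans i8) //.
  by rewrite /s1 upd_lt.
have s49 : s4 9 = enc (u b st).
  by rewrite /s4 updN // v3 /s2 updE /s1 updE updN // se shf_ok.
apply: (@prob_ge_runs _ _ _ _ _ (w :: ks, s4)).
  apply: (@runs_le _ _ (fcost N shf + 1).+3); first by lia.
  apply: runs_seq; apply: runs_assign; apply: runs_seq; apply: runs_trans r3 _.
  by apply: runs_assign; exact: runs_refl.
apply: IH; [by rewrite s4E | | exact: s49 | exact: inv_u | ].
  rewrite /s4 updE e3 // /s2 upd_lt // /s1 upd_lt //.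
  by move: sj; case: (s 7) => //= _ t [].
move=> s' st' ss s6 s9 ist'; apply: h => //; last by rewrite s6 s4E.
by apply: same_trans ss; split; rewrite s4E.
Qed.

Lemma rounds_run (f : St -> R) ks T i s st :
    spine (s 1%N) = N -> spine (s 6) = i -> s 9 = enc st -> inv st ->
    (forall s' st', same s s' -> s' 9 = enc st' -> inv st' ->
       prob_ge A (f st') T (ks, s')) ->
  prob_ge A (rounds u a N i st f) (i * round_cost N + 1 + T)%N
   (While (EVar 6) round_prog :: ks, s).
Proof.
set w := While _ _ => sN; elim: i s st sN => [|i IH] s st sN si se ist h.
  apply: prob_ge_runs (_ : runs _ (ks, s) 1) _; last exact: h.
  by apply: runs_while => /=; move: si; case: (s 6) => //= _; exact: runs_refl.
pose q2 := Seq (Assign 9 (ENode (EVar 8) (EVar 9))) (Seq (compile 9 asg) (Assign 6 (ETl (EVar 6)))).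
pose q1 := Seq (Toss 8) q2.
set s0 := upd s 7 (s 1).
have -> : (i.+1 * round_cost N + 1 + T = 5 + (N * toss_cost N + 1 +
    (1 + (fcost N asg + 4 + (i * round_cost N + 1 + T)).+1)))%N.
  by rewrite /round_cost; lia.
apply: (@prob_ge_runs _ _ _ _ _ (While (EVar 7)
     (Seq (Toss 8) (Seq (Assign 9 (ENode (EVar 8) (EVar 9)))
       (Seq (compile 9 shf) (Assign 7 (ETl (EVar 7)))))) :: q1 :: w :: ks, s0)).
  apply: (@runs_le _ _ 4) => //.
  apply: runs_while => /=; move: si; case: (s 6) => //= _ _ _.
  apply: runs_seq; apply: runs_assign; apply: runs_seq; exact: runs_refl.
apply: tosses_run => //.
move=> s1 st1 [e10 e11 e12 e14] e16 e19 ist1.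
apply: (@prob_ge_runs _ _ _ _ _ (Toss 8 :: q2 :: w :: ks, s1)).
  by apply: runs_seq; exact: runs_refl.
apply: prob_ge_toss => b.
set s2 := upd s1 8 _; set s3 := upd s2 9 (Node (s2 8) (s2 9)).
have [|//|s4 [r4 v4 e4]] := @compile_runs N asg 9 s3 (Assign 6 (ETl (EVar 6)) :: w :: ks).
  by [].
  by rewrite /s3 upd_lt // /s2 upd_lt // e11.
set s5 := upd s4 6 (tl (s4 6)).
have s5E k : (k < 8)%N -> k != 6 -> s5 k = s1 k.
  move=> k8 k6; rewrite /s5 updN // e4 ?(ltn_trans k8) // /s3 upd_lt ?(ltn_trans k8) //.
  by rewrite /s2 upd_lt.
have s59 : s5 9 = enc (a b st1).
  by rewrite /s5 updN // v4 /s3 updE /s2 updE updN // e19 asg_ok.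
have s5s : same s s5 by split; rewrite s5E ?e10 ?e11 ?e12 ?e14.
apply: (@prob_ge_runs _ _ _ _ _ (w :: ks, s5)).
  apply: (@runs_le _ _ (fcost N asg + 1).+3); first by lia.
  apply: runs_seq; apply: runs_assign; apply: runs_seq; apply: runs_trans r4 _.
  by apply: runs_assign; exact: runs_refl.
apply: IH; [by case: s5s => _ -> | | exact: s59 | exact: inv_a | ].
  rewrite /s5 updE e4 // /s3 upd_lt // /s2 upd_lt // e16 /s0 upd_lt //.
  by move: si; case: (s 6) => //= _ t [].
by move=> s' st' ss s9 ist'; apply: h => //; apply: same_trans s5s ss.
Qed.

(** [v] bounds what follows in terms of the answer so far; one run transforms it backwards, and
    repeated runs iterate this. *)
Definition body_value (v : bool -> R) (ans : bool) : R :=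
  rounds u a N N st0 (fun st => v (ans || check st)).

Lemma body_run (v : bool -> R) ks T s :
    spine (s 1%N) = N -> s 2 = x ->
    (forall s', s' 1%N = s 1%N -> s' 2 = s 2 -> s' 4 = s 4 ->
       prob_ge A (v (answer s')) T (ks, s')) ->
  prob_ge A (body_value v (answer s)) (body_cost N + T)%N (body_prog :: ks, s).
Proof.
move=> sN sx h.
pose q5 := If (EVar 9) (Assign 0 (ENode ELeaf ELeaf)) (Assign 8 ELeaf).
pose q4 := Seq (compile 9 chk) q5.
pose q3 := Seq (While (EVar 6) round_prog) q4.
set s1 := upd s 9 (s 2).
have [|//|s2 [r2 v2 e2]] := @compile_runs N ini 9 s1 (Seq (Assign 6 (EVar 1)) q3 :: ks).
  by [].
set s3 := upd s2 6 (s2 1).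
have s3E k : (k < 6)%N -> s3 k = s k.
  move=> k6; rewrite /s3 updN ?neq_ltn ?k6 // e2 ?(ltn_trans k6) //.
  by rewrite /s1 upd_lt ?(ltn_trans k6).
have -> : (body_cost N + T = (fcost N ini + 6) + (N * round_cost N + 1 + (fcost N chk + 3 + T)))%N.
  by rewrite /body_cost; lia.
apply: (@prob_ge_runs _ _ _ _ _ (While (EVar 6) round_prog :: q4 :: ks, s3)).
  apply: (@runs_le _ _ (fcost N ini + 3).+3); first by lia.
  apply: runs_seq; apply: runs_assign; apply: runs_seq.
  apply: runs_trans r2 _.
  apply: runs_seq; apply: runs_assign; apply: runs_seq; exact: runs_refl.
apply: (rounds_run (f := fun st => v (answer s || check st))) => //.
- by rewrite s3E.
- by rewrite /s3 updE e2 // /s1 upd_lt.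
- by rewrite /s3 updN // v2 /s1 updE sx ini_ok.
move=> s4 st4 [e0 e1 e22 e4] e9 ist4; rewrite !s3E // in e0 e1 e22 e4.
have [|//|s5 [r5 v5 e5]] := @compile_runs N chk 9 s4 (q5 :: ks); first by [].
  by rewrite e1.
have leaf5 : is_leaf (s5 9) = ~~ check st4 by rewrite v5 e9 chk_ok.
have e5' k : (k < 9)%N -> s5 k = s4 k by exact: e5.
pose s6 := if check st4 then upd s5 0 (Node Leaf Leaf) else upd s5 8 Leaf.
apply: (@prob_ge_runs _ _ _ _ _ (ks, s6)).
  apply: (@runs_le _ _ (fcost N chk + 2).+1); first by lia.
  apply: runs_seq; apply: runs_trans r5 _.
  apply: runs_if; rewrite /= leaf5 /s6; case: (check st4) => /=;
  by apply: runs_assign; exact: runs_refl.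
have -> : answer s || check st4 = answer s6.
  rewrite /answer /s6; case: (check st4); first by rewrite orbT updE.
  by rewrite orbF upd_lt // e5' // e0.
by apply: h; rewrite /s6; case: (check st4); rewrite updN // e5'.
Qed.

Fixpoint loop_cost (m : nat) : nat :=
  if m is m'.+1 then (loop_cost m' + loop_cost m' + 7)%N else (body_cost N + 7)%N.

Lemma loop_step ks s : s 4 <> Leaf ->
  runs (loop_prog :: ks, s)
    ((if is_leaf (hd (s 4)) then body_prog
      else Assign 4 (ENode (ETl (EVar 5)) (ENode (ETl (EVar 5)) (EVar 4)))) ::
     loop_prog :: ks,
     upd (upd s 5 (hd (s 4))) 4 (tl (s 4))) 6.
Proof.
move=> s4; apply: runs_while; rewrite [eval _ _]/=.
case e4: (s 4) s4 => [//|l r] _ /=.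
apply: runs_seq; apply: runs_assign; apply: runs_seq; apply: runs_assign.
rewrite /= upd_lt // e4 /=.
by apply: runs_if; rewrite /= updN // updE; exact: runs_refl.
Qed.

(** The stack simulates a binary recursion: a nonempty list on top is replaced by two copies of its
    tail, and an empty one is consumed by one run. *)
Lemma loop_run m : forall (v : bool -> R) ks T s,
    spine (s 1%N) = N -> s 2 = x -> spine (hd (s 4)) = m -> s 4 <> Leaf ->
    (forall s', s' 1%N = s 1%N -> s' 2 = s 2 -> s' 4 = tl (s 4) ->
       prob_ge A (v (answer s')) T (loop_prog :: ks, s')) ->
  prob_ge A (iter (2 ^ m) body_value v (answer s)) (loop_cost m + T)%N
    (loop_prog :: ks, s).
Proof.
elim: m => [|m IH] v ks T s sN sx sm s4 h.
  rewrite expn0 /= (_ : body_cost N + 7 + T = 6 + (body_cost N + T.+1))%N; last by lia.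
  apply: prob_ge_runs (loop_step _ s4) _.
  have -> : is_leaf (hd (s 4)) by move: sm; case: (hd _).
  set s1 := upd _ _ _; have -> : answer s = answer s1 by [].
  apply: body_run => // s' e1 e2 e4; apply: (prob_ge_le (lexx _) (leqnSn T)).
  by apply: h; rewrite ?e1 ?e2 ?e4.
rewrite expnS mul2n -addnn iterD.
rewrite (_ : loop_cost m.+1 + T = 6 + (1 + (loop_cost m + (loop_cost m + T))))%N; last first.
  by rewrite /=; lia.
apply: prob_ge_runs (loop_step _ s4) _.
case eh: (hd (s 4)) sm => [|l z] //= [sm].
set s1 := upd _ _ _.
set s2 := upd s1 4 (Node z (Node z (tl (s 4)))).
apply: (@prob_ge_runs _ _ _ _ _ (loop_prog :: ks, s2)).
  by apply: runs_assign; exact: runs_refl.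
have -> : answer s = answer s2 by [].
apply: (IH) => //; rewrite /s2 ?updE // => s' e1 e2 e4.
apply: IH => //; rewrite ?e1 ?e2 ?e4 //=.
Qed.

End Run.
End Scheme.

(** * Repetition *)

Lemma spine_nat_tree m : spine (nat_tree m) = m.
Proof. by elim: m => //= m ->. Qed.

(** Rounding [141 n / 365] up to whole blocks of 365 variables costs only a constant factor in
    time. *)
Definition exponent (n : nat) : nat := 141 * ((n + 364) %/ 365).

Section Main.
Variables (ini shf asg chk : fn) (k0 : nat).

Lemma eval_iter_node s m e : spine (eval s (iter m (ENode ELeaf) e)) = m + spine (eval s e).
Proof. by elim: m => //= m ->. Qed.

Lemma eval_iter_tl s m e : spine (eval s (iter m ETl e)) = spine (eval s e) - m.
Proof.
elim: m => [|m IH] /=; first by rewrite subn0.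
by rewrite subnS -IH; case: (eval _ _).
Qed.

Definition size_loop : prog :=
  While (EVar 5)
     (Seq (Assign 3 (iter 141 (ENode ELeaf) (EVar 3)))
          (Assign 5 (iter 365 ETl (EVar 5)))).

Lemma size_loop_runs n s ks : spine (s 5) = n ->
  exists s', [/\ runs (size_loop :: ks, s) (ks, s') (4 * n + 1),
    spine (s' 3) = exponent n + spine (s 3) & forall j, j < 3 -> s' j = s j].
Proof.
have [m] := ubnP n; elim: m n s => // m IH n s; rewrite ltnS => nm sn.
case: n nm sn => [|n] nm sn.
  exists s; split=> //; apply: runs_while => /=.
  by move: sn; case: (s 5) => //= _; exact: runs_refl.
set s1 := upd s 3 (eval s (iter 141 (ENode ELeaf) (EVar 3))).
set s2 := upd s1 5 (eval s1 (iter 365 ETl (EVar 5))).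
have [|//|s3 [r3 z3 e3]] := IH (n.+1 - 365) s2; first by lia.
  by rewrite /s2 updE eval_iter_tl /= /s1 updN // sn.
exists s3; split.
- apply: (@runs_le _ _ (4 * (n.+1 - 365) + 1).+4); first by lia.
  apply: runs_while; rewrite [eval _ _]/=; case: (s 5) sn => //= _ _ _.
  by apply: runs_seq; apply: runs_assign; apply: runs_assign.
- rewrite z3 /s2 updN // /s1 updE eval_iter_node /= /exponent; lia.
- by move=> j j3; rewrite e3 // /s2 upd_lt ?(ltn_trans j3) // /s1 upd_lt.
Qed.

Local Notation main := (main_prog ini shf asg chk k0).

Definition main_cost n : nat :=
  4 * n + 16 + (loop_cost ini shf asg chk (n + k0) (exponent n) + 1).

Section Run.
Variables (R : realFieldType) (St : Type) (enc : St -> tree) (inv : St -> bool).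
Variables (u a : bool -> St -> St) (check : St -> bool) (st0 : St).
Variables (n : nat) (F : tree).
Local Notation N := (n + k0).
Local Notation x := (Node (nat_tree n) F).
Local Open Scope ring_scope.

Hypothesis ini_ok : fval N ini x = enc st0.
Hypothesis inv0 : inv st0.
Hypothesis shf_ok : forall b st, inv st ->
  fval N shf (Node (bool_tree b) (enc st)) = enc (u b st).
Hypothesis inv_u : forall b st, inv st -> inv (u b st).
Hypothesis asg_ok : forall b st, inv st ->
  fval N asg (Node (bool_tree b) (enc st)) = enc (a b st).
Hypothesis inv_a : forall b st, inv st -> inv (a b st).
Hypothesis chk_ok : forall st, inv st -> is_leaf (fval N chk (enc st)) = ~~ check st.

Local Notation bval := (body_value u a check st0 N).

Lemma main_run (A : config -> bool) (v : bool -> R) :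
    (forall s, v (answer s) <= (A ([::], s))%:R) ->
  prob_ge A (iter (2 ^ exponent n) bval v false) (main_cost n) (init main x).
Proof.
move=> vA; rewrite /init /main_prog -/(size_loop).
set s0 := upd _ _ _; set k1 := Seq (Assign 4 _) _.
pose s1 := upd s0 1 (eval s0 (iter k0 (ENode ELeaf) (EHd (EVar 0)))).
pose s2 := upd (upd (upd s1 2 (s1 0%N)) 0 Leaf) 5 (nat_tree n).
have [|s3 [r3 z3 e3]] := @size_loop_runs n s2 [:: k1].
  by rewrite /s2 updE spine_nat_tree.
set s4 := upd s3 4 (Node (s3 3) Leaf).
have s4E j : (j < 3)%N -> s4 j = s2 j by move=> j3; rewrite /s4 upd_lt ?e3 // (ltn_trans j3).
apply: (@prob_ge_runs _ _ _ _ _ ([:: loop_prog ini shf asg chk], s4)).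
  apply: (@runs_le _ _ (4 * n + 1 + 2).+1.+4.+4); first by lia.
  apply: runs_seq; apply: runs_assign; apply: runs_seq; apply: runs_assign.
  apply: runs_seq; apply: runs_assign; apply: runs_seq; apply: runs_assign.
  apply: runs_seq; apply: runs_trans r3 _.
  by apply: runs_seq; apply: runs_assign; exact: runs_refl.
have -> : false = answer s4 by rewrite /answer s4E.
apply: (loop_run ini_ok inv0 shf_ok inv_u asg_ok inv_a chk_ok) => //.
- by rewrite s4E // /s2 !updN // /s1 updE eval_iter_node /= spine_nat_tree addnC.
- by rewrite s4E.
- by rewrite /s4 updE /= z3 addn0.
move=> s5 _ _ e5; apply: (@prob_ge_runs _ _ _ _ _ ([::], s5) 1).
  by apply: runs_while; rewrite /= e5; exact: runs_refl.
by apply: prob_ge_halted.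
Qed.

Lemma prob_card_tuple (A : config -> bool) t c :
  1 <= prob R A t c -> forall r : t.-tuple bool, A (foldl step c r).
Proof.
rewrite prob_card ler_pdivlMr ?exprn_gt0 // mul1r -natrX ler_nat => le r.
have /eqP/setP/(_ r) : [set r : t.-tuple bool | A (foldl step c r)] == setT.
  by rewrite eqEcard subsetT cardsT card_tuple card_bool.
by rewrite !inE.
Qed.

Lemma body_value_const (v : bool -> R) (c : R) ans : v =1 (fun=> c) -> bval v ans = c.
Proof.
move=> vc; rewrite /body_value -[RHS]addr0 -(mul0r (rounds u a N N st0 (fun=> 0))).
by rewrite -rounds_affine; apply: eq_rounds => st; rewrite mul0r addr0 vc.
Qed.

(** [body_value] preserves the constant bound 1, so halting has probability 1; with finitely many
    fair coins this means every coin string. *)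
Lemma main_halts : runs_in_time main x (main_cost n).
Proof.
move=> r; apply: (@prob_card_tuple halted); rewrite /run.
have h := @main_run halted (fun=> 1) (fun=> lexx _) (main_cost n) (leqnn _).
apply: le_trans h; rewrite le_eqVlt; apply/orP; left; apply/eqP/esym.
elim: (2 ^ exponent n)%N false => [|k IH] ans //=.
by apply: body_value_const.
Qed.

Lemma main_rejects t : (main_cost n <= t)%N -> (forall st, inv st -> ~~ check st) ->
  forall r : t.-tuple bool, ~~ accepting (run main x r).
Proof.
move=> le nchk r; pose A c := halted c && ~~ accepting c.
suff /andP[] : A (run main x r) by [].
apply: (@prob_card_tuple A).
pose v b : R := (~~ b)%:R.
have vA s : v (answer s) <= (A ([::], s))%:R by [].
apply: le_trans (main_run vA le).
rewrite le_eqVlt; apply/orP; left; apply/eqP/esym.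
elim: (2 ^ exponent n)%N => [|k IH] //=.
rewrite /body_value -[RHS]addr0 -(mul0r (rounds u a N N st0 (fun=> 0))).
rewrite -rounds_affine; apply: (@eq_rounds_in _ _ _ _ _ inv) => // st ist.
by rewrite (negPf (nchk st ist)) IH mul0r addr0.
Qed.

(** With [M] runs of success probability [P], [(1 - P)^M (1 + P)^M <= 1] and Bernoulli's inequality
    [(1 + P)^M >= 1 + M P >= 2] bound the failure probability [(1 - P)^M] by 1/2. *)
Lemma main_accepts t (p : R) : (main_cost n <= t)%N ->
    p <= rounds u a N N st0 (fun st => (check st)%:R) -> 0 <= p ->
    1 <= (2 ^ exponent n)%:R * p ->
  1 / 2 <= prob R accepting t (init main x).
Proof.
move=> le pE p0 Mp; pose v (b : bool) : R := b%:R.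
have vA s : v (answer s) <= (accepting ([::], s))%:R by [].
apply: le_trans (main_run vA le).
set M := (2 ^ exponent n)%N in Mp *.
set P := rounds _ _ _ _ _ _ in pE.
have P1 : P <= 1.
  have -> : 1 = rounds u a N N st0 (fun=> 1) :> R.
    by rewrite -[LHS](@body_value_const (fun=> 1) 1 false).
  rewrite /P -subr_ge0.
  have -> : rounds u a N N st0 (fun=> 1) - rounds u a N N st0 (fun st => (check st)%:R) =
     rounds u a N N st0 (fun st => 1 - (check st)%:R) :> R.
    rewrite (@eq_rounds _ _ _ _ _ _ _ (fun st => 1 - (check st)%:R)
       (fun st => 1 + -1 * (check st)%:R)); last by move=> st; rewrite mulN1r.
    rewrite rounds_affine mulN1r; congr (_ - _).
    exact: (@body_value_const (fun=> 1) 1 false).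
  by apply: rounds_ge0 => st; case: (check st); rewrite ?subrr ?subr0.
have it k : forall ans, iter k bval v ans = if ans then 1 else 1 - (1 - P) ^+ k.
  elim: k => [|k IH] ans /=; first by rewrite /v expr0 subrr; case: ans.
  rewrite /body_value; case: ans.
    rewrite (@eq_rounds _ _ _ _ _ _ _ _ (fun=> 1)); last by move=> st; rewrite IH.
    exact: (@body_value_const (fun=> 1) 1 false).
  rewrite (@eq_rounds _ _ _ _ _ _ _ _ (fun st => (1 - (1 - P) ^+ k) + (1 - P) ^+ k * (check st)%:R)).
    by rewrite rounds_affine -/P exprS; ring.
  by move=> st; rewrite IH /=; case: (check st); rewrite ?mulr1 ?mulr0 ?addr0 ?subrK.
rewrite it.
have q0 : 0 <= 1 - P by rewrite subr_ge0.
have P0 : 0 <= P by exact: le_trans pE.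
have bern k : 1 + k%:R * P <= (1 + P) ^+ k.
  elim: k => [|k IH]; first by rewrite mul0r addr0 expr0.
  rewrite exprS; apply: (@le_trans _ _ ((1 + P) * (1 + k%:R * P))).
    have : 0 <= k%:R * (P * P) by rewrite !mulr_ge0.
    by rewrite -natr1; lra.
  by rewrite ler_wpM2l // addr_ge0.
have le1 : (1 - P) ^+ M * (1 + P) ^+ M <= 1.
  rewrite -exprMn exprn_ile1 //; first by rewrite mulr_ge0 // addr_ge0.
  have : 0 <= P * P by rewrite mulr_ge0.
  lra.
have le2 : (1 - P) ^+ M * 2 <= 1.
  apply: le_trans le1; apply: ler_wpM2l; first exact: exprn_ge0.
  apply: le_trans (bern M).
  have : M%:R * p <= M%:R * P by rewrite ler_wpM2l.
  lra.
lra.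
Qed.

End Run.
End Main.

(** * Programs on lists *)

Local Notation inp := (EVar 0).
Local Notation tt_expr := (ENode ELeaf ELeaf).

Definition truthy (t : tree) : bool := ~~ is_leaf t.

Lemma truthy_bool_tree b : truthy (bool_tree b) = b.
Proof. by case: b. Qed.

Definition FNot (p : fn) : fn := FIf p (FExp ELeaf) (FExp tt_expr).

Lemma FNotE N p x : fval N (FNot p) x = bool_tree (~~ truthy (fval N p x)).
Proof. by rewrite /= /truthy; case: (is_leaf _). Qed.

(* On input [(l, (acc, env))], folds [f : (element, (acc, env)) -> acc] over [l]. *)
Definition FFold (k : nat) (f : fn) : fn :=
  FComp (FExp (EHd (ETl inp))) (iter k FFor
    (FIf (FExp (EHd inp))
      (FPair (FExp (ETl (EHd inp)))
        (FPair (FComp f (FExp (ENode (EHd (EHd inp)) (ETl inp)))) (FExp (ETl (ETl inp)))))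
      (FExp inp))).

Definition FAny (k : nat) (p : fn) : fn :=
  FComp (FFold k (FIf (FExp (EHd (ETl inp))) (FExp tt_expr)
           (FComp p (FExp (ENode (EHd inp) (ETl (ETl inp)))))))
    (FExp (ENode (EHd inp) (ENode ELeaf (ETl inp)))).

Definition FAll (k : nat) (p : fn) : fn := FNot (FAny k (FNot p)).

Section Combinators.
Variable N : nat.

Lemma fval_iter_FFor k f x : fval N (iter k FFor f) x = iter (N ^ k) (fval N f) x.
Proof.
elim: k x => [|k IH] x; first by rewrite expn0.
by rewrite [LHS]/= (eq_iter IH) expnS iterM.
Qed.

Lemma FFoldE (T : Type) (e : T -> tree) k f (s : seq T) acc env : size s <= N ^ k ->
  fval N (FFold k f) (Node (seq_tree e s) (Node acc env)) =
  foldl (fun acc a => fval N f (Node (e a) (Node acc env))) acc s.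
Proof.
move=> sk; rewrite /FFold [LHS]/= fval_iter_FFor; set g := fval _ _.
pose F' := fun acc a => fval N f (Node (e a) (Node acc env)).
suff -> : iter (N ^ k) g (Node (seq_tree e s) (Node acc env)) =
  Node Leaf (Node (foldl F' acc s) env) by [].
elim: (N ^ k) s acc sk => [|m IH] [|a s] acc // sm; first by rewrite iterS IH.
by rewrite iterSr IH.
Qed.

Lemma FAnyE (T : Type) (e : T -> tree) k p (s : seq T) env : size s <= N ^ k ->
  truthy (fval N (FAny k p) (Node (seq_tree e s) env)) =
  has (fun a => truthy (fval N p (Node (e a) env))) s.
Proof.
move=> sk; rewrite /FAny; set f := FIf _ _ _.
rewrite -[fval _ _ _]/(fval N (FFold k f) (Node (seq_tree e s) (Node Leaf env))) FFoldE //.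
rewrite -[RHS]orFb -[false]/(truthy Leaf); elim: s Leaf {sk} => [|a s IH] acc.
  by rewrite orbF.
rewrite [foldl _ _ _]/= IH /truthy /=; case: (is_leaf acc) => //=.
Qed.

Lemma FAllE (T : Type) (e : T -> tree) k p (s : seq T) env : size s <= N ^ k ->
  fval N (FAll k p) (Node (seq_tree e s) env) =
  bool_tree (all (fun a => truthy (fval N p (Node (e a) env))) s).
Proof.
move=> sk; rewrite FNotE FAnyE // -all_predC; congr bool_tree; apply: eq_all => a; rewrite -[LHS]/(~~ truthy (fval N (FNot p) (Node (e a) env))).
by rewrite FNotE truthy_bool_tree negbK.
Qed.

(** Nodes are taken off both numbers in step until one is empty; they are equal when both are empty
    then. *)
Definition FEqn : fn :=
  FComp (FIf (FExp (EHd inp)) (FExp ELeaf)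
           (FIf (FExp (ETl inp)) (FExp ELeaf) (FExp tt_expr)))
    (FFor (FIf (FExp (EHd inp))
       (FIf (FExp (ETl inp)) (FExp (ENode (ETl (EHd inp)) (ETl (ETl inp)))) (FExp inp))
       (FExp inp))).

Lemma FEqnE m k : m <= N ->
  truthy (fval N FEqn (Node (nat_tree m) (nat_tree k))) = (m == k).
Proof.
rewrite /FEqn [fval _ _ _]/=; set f := fun _ => _.
have it j : forall m k, m <= j ->
    iter j f (Node (nat_tree m) (nat_tree k)) = Node (nat_tree (m - k)) (nat_tree (k - m)).
  elim: j => [|j IH] [|m'] k' // lt; rewrite ?subn0 ?sub0n //.
    by rewrite iterS IH // subn0 sub0n.
  case: k' => [|k']; last by rewrite iterSr IH.
  have fix1 t : f (Node t Leaf) = Node t Leaf by case: t.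
  by elim: (j.+1) => // i IHi; rewrite iterS IHi fix1.
move=> /it ->; rewrite eqn_leq /leq /=.
by case: (m - k) => [|i]; case: (k - m) => [|j].
Qed.

End Combinators.

(** * Programs for PPSZ *)

(* Input [(l, m)]. *)
Definition FEqLit : fn :=
  FIf (FComp FEqn (FExp (ENode (EHd (EHd inp)) (EHd (ETl inp)))))
    (FIf (FExp (ETl (EHd inp))) (FExp (ETl (ETl inp))) (FNot (FExp (ETl (ETl inp)))))
    (FExp ELeaf).

(* Input [(rho, l)]. *)
Definition FMem : fn := FAny 1 FEqLit.

Definition FNeg : fn := FPair (FExp (EHd inp)) (FNot (FExp (ETl inp))).

(* Input [(rho, F)]. *)
Fixpoint FRefuted (d : nat) : fn :=
  if d is d'.+1 then
    FComp (FAny 4 (FAll 1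
      (FIf (FComp FMem (FPair (FExp (EHd (ETl inp))) (FComp FNeg (FExp (EHd inp)))))
        (FExp tt_expr)
        (FComp (FRefuted d')
          (FExp (ENode (ENode (EHd inp) (EHd (ETl inp))) (ETl (ETl inp))))))))
      (FExp (ENode (ETl inp) inp))
  else FExp ELeaf.

(* Input [(l, r)]; computes [catrev l r]. *)
Definition FRev : fn :=
  FComp (FFold 1 (FExp (ENode (EHd inp) (EHd (ETl inp)))))
    (FExp (ENode (EHd inp) (ENode (ETl inp) ELeaf))).

(* A list with a distinguished position is a zipper [(l, r)]: [l] is the part
   before the position, reversed. *)
Definition FNext : fn :=
  FIf (FExp (ETl inp))
    (FIf (FExp (ETl (ETl inp)))
      (FExp (ENode (ENode (EHd (ETl inp)) (EHd inp)) (ETl (ETl inp))))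
      (FPair (FExp ELeaf)
        (FComp FRev (FExp (ENode (ENode (EHd (ETl inp)) (EHd inp)) ELeaf)))))
    (FExp inp).

(** A zipper at position [p] has [p] elements on its left; moving on once for each of them doubles
    the position modulo the length, without arithmetic. *)
Definition FDouble : fn :=
  FComp (FFold 1 (FComp FNext (FExp (EHd (ETl inp)))))
    (FExp (ENode (EHd inp) (ENode inp ELeaf))).

(* States are encoded as [(F, (rho, zipper))]. *)
Definition FAdvance : fn :=
  FPair (FExp (EHd (ETl inp))) (FPair (FExp (EHd (ETl (ETl inp))))
    (FIf (FExp (EHd inp))
      (FComp FNext (FComp FDouble (FExp (ETl (ETl (ETl inp))))))
      (FComp FDouble (FExp (ETl (ETl (ETl inp))))))).

(* Input [(b, (F, (rho, (l, y :: r))))]. *)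
Definition FChosen (d : nat) : fn :=
  let y := EHd (ETl (ETl (ETl (ETl inp)))) in
  let rho := EHd (ETl (ETl inp)) in
  let F := EHd (ETl inp) in
  FIf (FComp (FRefuted d) (FExp (ENode (ENode (ENode y ELeaf) rho) F)))
    (FExp tt_expr)
    (FIf (FComp (FRefuted d) (FExp (ENode (ENode (ENode y tt_expr) rho) F)))
      (FExp ELeaf)
      (FExp (EHd inp))).

Definition FAssign (d : nat) : fn :=
  FIf (FExp (ETl (ETl (ETl (ETl inp)))))
    (FPair (FExp (EHd (ETl inp)))
      (FPair
        (FPair (FPair (FExp (EHd (ETl (ETl (ETl (ETl inp)))))) (FChosen d))
               (FExp (EHd (ETl (ETl inp)))))
        (FPair (FExp ELeaf)
          (FComp FRev (FExp (ENode (EHd (ETl (ETl (ETl inp))))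
                                   (ETl (ETl (ETl (ETl (ETl inp)))))))))))
    (FExp (ETl inp)).

(* Input [(n, F)]. *)
Definition FInit : fn :=
  FPair (FExp (ETl inp)) (FPair (FExp ELeaf) (FPair (FExp ELeaf)
    (FComp (FComp (FExp (ETl inp))
       (FFor (FIf (FExp (EHd inp))
                (FExp (ENode (ETl (EHd inp)) (ENode (ETl (EHd inp)) (ETl inp))))
                (FExp inp))))
      (FExp (ENode (EHd inp) ELeaf))))).

Definition FSolved : fn :=
  FComp (FAll 4 (FAny 1 (FComp FMem (FExp (ENode (ETl inp) (EHd inp))))))
    (FExp (ENode (EHd inp) (EHd (ETl inp)))).

(** * The programs compute the steps of PPSZ *)

Section Correct.
Variables (n : nat) (F : cnf n) (d N : nat).
Hypothesis nN : n + d < N.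
Hypothesis N3 : 3 <= N.
Hypothesis FN : size F <= N ^ 4.
Hypothesis F3 : all (fun C : clause n => size C <= 3) F.
Implicit Types (l m : literal n) (rho : seq (literal n)) (W : seq 'I_n).

Local Notation lt := (@literal_tree n).
Local Notation rt := (seq_tree (@literal_tree n)).
Local Notation ft := (seq_tree (seq_tree (@literal_tree n))).
Local Notation vt := (seq_tree (fun y : 'I_n => nat_tree y)).

Lemma FEqLitE l m : truthy (fval N FEqLit (Node (lt l) (lt m))) = (l == m).
Proof.
have lN : l.1 <= N by apply: leq_trans (ltnW (ltn_ord _)) _; lia.
have := @FEqnE N l.1 m.1 lN; rewrite /FEqLit.
case: l m {lN} => y b [z c]; move: FEqn => q; rewrite /truthy /=.
case: (is_leaf (fval _ q _)) => /esym yz; rewrite xpair_eqE -[y == z](inj_eq val_inj) yz //=.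
by case: b; case: c.
Qed.

Lemma FMemE rho l : size rho <= N ->
  truthy (fval N FMem (Node (rt rho) (lt l))) = (l \in rho).
Proof.
move=> rN; rewrite /FMem FAnyE ?expn1 // -has_pred1; apply: eq_has => m.
by rewrite FEqLitE.
Qed.

Lemma FNegE l : fval N FNeg (lt l) = lt (neg l).
Proof. by case: l => y []. Qed.

Lemma FRefutedE k rho : size rho + k <= N ->
  truthy (fval N (FRefuted k) (Node (rt rho) (ft F))) = refuted F k rho.
Proof.
elim: k rho => [|k IH] rho rk //; rewrite [refuted _ _ _]/=.
set p := FIf (FComp FMem (FPair (FExp (EHd (ETl inp))) (FComp FNeg (FExp (EHd inp)))))
        (FExp tt_expr)
        (FComp (FRefuted k)
          (FExp (ENode (ENode (EHd inp) (EHd (ETl inp))) (ETl (ETl inp))))).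
rewrite -[fval _ _ _]/(fval N (FAny 4 (FAll 1 p)) (Node (ft F) (Node (rt rho) (ft F)))).
rewrite FAnyE //; apply: eq_in_has => C CF.
rewrite FAllE ?truthy_bool_tree; last first.
  by rewrite expn1; apply: leq_trans (allP F3 _ CF) N3.
apply: eq_all => l.
have -> : fval N p (Node (lt l) (Node (rt rho) (ft F))) =
  if truthy (fval N FMem (Node (rt rho) (lt (neg l)))) then Node Leaf Leaf
  else fval N (FRefuted k) (Node (rt (l :: rho)) (ft F)).
  rewrite -FNegE /p /truthy [LHS]/=; by case: (is_leaf _).
rewrite FMemE; last by apply: leq_trans rk; exact: leq_addr.
by case: ifP => // _; rewrite IH // addSnnS.
Qed.

Lemma FRevE (T : Type) (e : T -> tree) (s1 s2 : seq T) : size s1 <= N ->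
  fval N FRev (Node (seq_tree e s1) (seq_tree e s2)) = seq_tree e (catrev s1 s2).
Proof.
move=> sN; set f := FExp (ENode (EHd inp) (EHd (ETl inp))).
rewrite -[LHS]/(fval N (FFold 1 f) (Node (seq_tree e s1) (Node (seq_tree e s2) Leaf))).
rewrite FFoldE ?expn1 //; elim: s1 s2 {sN} => //= a s1 IH s2.
by rewrite -IH.
Qed.

Definition zipper W p : tree := Node (vt (rev (take p W))) (vt (drop p W)).

Lemma FNextE W p : size W <= n -> p < size W ->
  fval N FNext (zipper W p) = zipper W (p.+1 %% size W).
Proof.
move=> Wn pW.
case eD: (drop p W) => [|y [|z r]].
- by move: pW; rewrite -subn_gt0 -size_drop eD.
- have pe : p.+1 = size W.
    by have := size_drop p W; rewrite eD /=; lia.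
  rewrite pe modnn /zipper eD take0 drop0.
  rewrite -[LHS]/(Node Leaf (fval N FRev (Node (vt (y :: rev (take p W))) (vt [::])))).
  rewrite FRevE; last by rewrite /= size_rev size_take pW; lia.
  by rewrite -[in RHS](cat_take_drop p W) eD catrevE rev_cons revK cats0 cats1.
- have pe : p.+1 < size W.
    by have := size_drop p W; rewrite eD /=; lia.
  rewrite modn_small // /zipper eD (take_nth y) // rev_rcons.
  have <- : y = nth y W p by rewrite -[p]addn0 -nth_drop eD.
  have -> : drop p.+1 W = z :: r by rewrite -add1n -drop_drop eD.
  by [].
Qed.

Lemma FDoubleE W p : size W <= n -> p < size W ->
  fval N FDouble (zipper W p) = zipper W ((p + p) %% size W).
Proof.
move=> Wn pW; set f := FComp FNext (FExp (EHd (ETl inp))).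
rewrite -[LHS]/(fval N (FFold 1 f) (Node (vt (rev (take p W))) (Node (zipper W p) Leaf))).
rewrite FFoldE ?expn1; last by rewrite size_rev size_take pW; lia.
pose g := fun acc (a : 'I_n) => fval N f (Node (nat_tree a) (Node acc Leaf)).
have step s : forall q, q < size W -> foldl g (zipper W q) s =
    zipper W ((q + size s) %% size W).
  elim: s => [|a s IH] q qW; first by rewrite /= addn0 modn_small.
  rewrite -[LHS]/(foldl g (fval N FNext (zipper W q)) s) FNextE //.
  by rewrite IH ?ltn_pmod ?(leq_ltn_trans _ qW) // modnDml addSnnS.
by rewrite step // size_rev size_take pW.
Qed.

Lemma FDouble_nil : fval N FDouble (Node Leaf Leaf) = Node Leaf Leaf.
Proof.
rewrite -[LHS]/(fval N (FFold 1 (FComp FNext (FExp (EHd (ETl inp)))))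
  (Node (seq_tree nat_tree [::]) (Node (Node Leaf Leaf) Leaf))).
by rewrite FFoldE.
Qed.

Definition pstate_tree (st : pstate n) : tree :=
  let: (rho, W, p) := st in Node (ft F) (Node (rt rho) (zipper W p)).

Definition pstate_inv (st : pstate n) : bool :=
  let: (rho, W, p) := st in
  uniq (map fst rho ++ W) && ((p < size W) || nilp W).

Lemma inv_size rho W p : pstate_inv (rho, W, p) -> size rho + size W <= n.
Proof.
case/andP => u _; rewrite -(size_map fst) -size_cat -(card_uniqP u).
by rewrite -[leqRHS]card_ord max_card.
Qed.

Lemma zipper_nil p : zipper [::] p = Node Leaf Leaf.
Proof. by case: p. Qed.

Lemma inv_advance b st : pstate_inv st -> pstate_inv (advance b st).
Proof.
case: st => [[rho W] p] /= /andP[-> /= pW]; case: W pW => // y W _.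
by rewrite ltn_pmod.
Qed.

Lemma FAdvanceE b st : pstate_inv st ->
  fval N FAdvance (Node (bool_tree b) (pstate_tree st)) = pstate_tree (advance b st).
Proof.
case: st => [[rho W] p] invst; have sn := inv_size invst; case/andP: invst => _ pW.
set t := zipper W p.
transitivity (Node (ft F) (Node (rt rho)
    (if b then fval N FNext (fval N FDouble t) else fval N FDouble t))).
  by case: b.
congr (Node _ (Node _ _)); rewrite {}/t; move: pW => /orP[pW|/nilP ->]; last first.
  by rewrite !zipper_nil FDouble_nil; case: b.
have Wn : size W <= n by apply: leq_trans sn; exact: leq_addl.
have W0 : 0 < size W by exact: leq_ltn_trans pW.
rewrite FDoubleE //; case: b; last by rewrite addnn addn0.
by rewrite FNextE ?ltn_pmod // -addn1 modnDml addnn.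
Qed.

Lemma inv_assign b st : pstate_inv st -> pstate_inv (assign F d b st).
Proof.
case: st => [[rho W] p] /=; case eD: (drop p W) => [//|y r] /andP[u _].
apply/andP; split; last by rewrite /nilp; case: (size _).
rewrite (perm_uniq (_ : perm_eq _ (map fst rho ++ W))) //=.
rewrite -{2}(cat_take_drop p W) eD catA [inp in perm_eq _ inp]catA -cat1s -(cat1s y r).
by rewrite perm_catCA.
Qed.

Lemma FAssignE b st : pstate_inv st ->
  fval N (FAssign d) (Node (bool_tree b) (pstate_tree st)) = pstate_tree (assign F d b st).
Proof.
case: st => [[rho W] p] invst; have sn := inv_size invst; case/andP: invst => _ pW.
rewrite /pstate_tree /assign /zipper.
case eD: (drop p W) => [|y r]; first by rewrite eD.
have pW' : p < size W by rewrite -subn_gt0 -size_drop eD.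
have srho : size rho + d < N by lia.
transitivity (Node (ft F) (Node (Node (Node (nat_tree y)
   (if truthy (fval N (FRefuted d) (Node (rt ((y, false) :: rho)) (ft F))) then Node Leaf Leaf
    else if truthy (fval N (FRefuted d) (Node (rt ((y, true) :: rho)) (ft F))) then Leaf
    else bool_tree b)) (rt rho))
   (Node Leaf (fval N FRev (Node (vt (rev (take p W))) (vt r)))))).
  rewrite [LHS]/=; congr (Node _ (Node (Node (Node _ _) _) _)).
  by rewrite /truthy; case: (is_leaf _) => //; case: (is_leaf _).
rewrite FRevE; last by rewrite size_rev size_take pW'; lia.
rewrite !FRefutedE ?catrevE ?revK //=; try by rewrite addSn.
rewrite take0 drop0; congr (Node _ (Node (Node (Node _ _) _) _)).
rewrite /chosen /forced /=.
by case: (refuted _ _ _) => //; case: (refuted _ _ _).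
Qed.

Lemma FInitE : fval N FInit (cnf_tree F) = pstate_tree ([::], enum 'I_n, 0).
Proof.
rewrite /cnf_tree /pstate_tree /zipper take0 drop0.
rewrite [LHS]/=; congr (Node _ (Node _ (Node _ _))); set g := fun _ => _.
have it j : forall k s, k <= j ->
    iter j g (Node (nat_tree k) (seq_tree nat_tree s)) =
    Node Leaf (seq_tree nat_tree (iota 0 k ++ s)).
  elim: j => [|j IH] [|k] s kj //; first by rewrite iterS IH.
  rewrite iterSr -[g _]/(Node (nat_tree k) (seq_tree nat_tree (k :: s))) IH //.
  by rewrite -[k.+1]addn1 iotaD -catA.
have {}it : iter N g (Node (nat_tree n) (seq_tree nat_tree [::])) =
    Node Leaf (seq_tree nat_tree (iota 0 n ++ [::])).
  by apply: it; lia.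
rewrite it /=.
rewrite cats0 -val_enum_ord /= /seq_tree.
by elim: (enum _) => //= y s ->.
Qed.

Lemma FSolvedE st : pstate_inv st ->
  is_leaf (fval N FSolved (pstate_tree st)) = ~~ solved F st.1.1.
Proof.
case: st => [[rho W] p] /inv_size sn; rewrite -[LHS]negbK -/(truthy _); congr (~~ _).
pose q := FAny 1 (FComp FMem (FExp (ENode (ETl inp) (EHd inp)))).
rewrite -[fval _ _ _]/(fval N (FAll 4 q) (Node (ft F) (rt rho))) FAllE //.
rewrite truthy_bool_tree; apply: eq_in_all => C CF.
rewrite FAnyE ?expn1; last by apply: leq_trans (allP F3 _ CF) N3.
apply: eq_has => l; rewrite -[fval _ _ _]/(fval N FMem (Node (rt rho) (lt l))).
by rewrite FMemE //; lia.
Qed.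

(** The variables of [rho] are distinct, so it never holds both literals of a variable, and setting
    exactly its positive ones to true satisfies all of it. This is where the error becomes
    one-sided. *)
Lemma solved_satisfiable rho W p : pstate_inv (rho, W, p) -> solved F rho -> satisfiable F.
Proof.
case/andP; rewrite cat_uniq => /andP[u _] _ /allP sF.
exists [ffun y => (y, true) \in rho]; apply/allP => C /sF /hasP[[y b] lC /= yb].
apply/hasP; exists (y, b) => //=; rewrite ffunE; case: b yb {lC} => yb.
  by rewrite yb.
rewrite eqbF_neg; apply/negP => yt.
have : uniq (map fst rho) -> (y, true) = (y, false); last by move/(_ u).
move: yb yt {u sF}; elim: rho => //= l rho IH; rewrite !in_cons.
case/orP => [/eqP<-|yb]; case/orP => [/eqP // <-|yt] /=.
- by rewrite (map_f fst yt).
- by rewrite (map_f fst yb).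
by case/andP => _; exact: IH.
Qed.

End Correct.

(** * Running time *)

(** Padded with [None], a clause becomes a triple over the [2 n] literals and one blank, and [F] has
    no repetition. *)
Lemma kcnf_size (n : nat) (F : cnf n) : is_kcnf 3 F -> size F <= (2 * n).+1 ^ 3.
Proof.
case/andP => uF /allP F3.
pose g (C : clause n) := let s := map Some C in
  (nth None s 0, nth None s 1, nth None s 2).
have inj : {in F &, injective g}.
  move=> C D /F3 + /F3; case: C => [|c1 [|c2 [|c3 [|]]]] //=;
    by case: D => [|d1 [|d2 [|d3 [|]]]] //= _ _ [] *; congruence.
have : uniq (map g F) by rewrite map_inj_in_uniq.
move/card_uniqP; rewrite size_map => <-; apply: leq_trans (max_card _) _.
rewrite !card_prod !card_option card_prod card_ord card_bool.
by rewrite !expnS expn0 muln1 mulnA (mulnC n).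
Qed.

Local Open Scope ring_scope.

(** With [(1 + h)^2 <= b], one factor [(1 + h)^m] bounds the power [e] by induction and the other
    bounds [h (m + 1)] by Bernoulli's inequality, as [h <= 1]. *)
Lemma poly_le_exp (b : rat) e : 1 < b ->
  exists K : rat, 0 <= K /\ forall m : nat, m.+1%:R ^+ e <= K * b ^+ m.
Proof.
elim: e b => [|e IH] b b1.
  by exists 1; split=> // m; rewrite expr0 mul1r exprn_ege1 // ltW.
have [h [h0 h1 hb]] : exists h : rat, [/\ 0 < h, h <= 1 & (1 + h) * (1 + h) <= b].
  (* [(1 + h)^2 <= 1 + 3 h] for [h <= 1]. *)
  exists (Num.min ((b - 1) / 3) 1); set h := Num.min _ _.
  have h1 : h <= 1 by rewrite ge_min lexx orbT.
  have h0 : 0 < h by rewrite lt_min ltr01 andbT divr_gt0 // subr_gt0.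
  have hb : h <= (b - 1) / 3 by rewrite ge_min lexx.
  have : h * h <= h by rewrite -[leRHS]mulr1; apply: ler_wpM2l => //; exact: ltW.
  by split=> //; lra.
have [K [K0 KP]] := IH (1 + h) ltac:(lra).
exists (K / h); split; first by rewrite divr_ge0 // ltW.
move=> m; rewrite exprSr.
have bern : 1 + h * m%:R <= (1 + h) ^+ m.
  elim: m => [|m IHm]; first by rewrite mulr0 addr0 expr0.
  rewrite exprS -natr1; apply: (@le_trans _ _ ((1 + h) * (1 + h * m%:R))).
    have : 0 <= h * (h * m%:R) by rewrite !mulr_ge0 // ltW.
    lra.
  by rewrite ler_wpM2l // addr_ge0 // ltW.
apply: (@le_trans _ _ (K * (1 + h) ^+ m * ((1 + h) ^+ m / h))).
  apply: ler_pM => //; first exact: exprn_ge0.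
  by rewrite ler_pdivlMr // mulrC -natr1; lra.
have -> : K * (1 + h) ^+ m * ((1 + h) ^+ m / h) = K / h * ((1 + h) * (1 + h)) ^+ m.
  by rewrite exprMn; ring.
rewrite ler_wpM2l ?divr_ge0 // ?(ltW h0) // lerXn2r ?nnegrE //; last by lra.
by rewrite mulr_ge0 // addr_ge0 // ltW.
Qed.

Local Close Scope ring_scope.

Lemma loop_cost_le ini shf asg chk N m :
  loop_cost ini shf asg chk N m <= 2 ^ m * (body_cost ini shf asg chk N + 14).
Proof.
(* The shift by 7 turns the recursion [2 c + 7] into plain doubling. *)
suff : loop_cost ini shf asg chk N m + 7 <= 2 ^ m * (body_cost ini shf asg chk N + 14).
  exact/leq_trans/leq_addr.
elim: m => [|m IH] /=; first by rewrite mul1n -addnA.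
by rewrite expnS -mulnA mul2n -addnn; apply: leq_trans (leq_add IH IH); lia.
Qed.

Lemma poly_bounded_body ini shf asg chk : poly_bounded (body_cost ini shf asg chk).
Proof.
rewrite /body_cost /round_cost /toss_cost.
by repeat (apply: poly_bounded_add || apply: poly_bounded_mul);
  (exact: poly_bounded_cst || exact: poly_bounded_id || exact: poly_bounded_fcost).
Qed.

Local Open Scope ring_scope.

(** One step of binary exponentiation on [l * 2^f]: [b] is the next bit of the exponent and [g]
    renormalises the mantissa. The exponents 1, 2, 5, 11, ... below are the binary prefixes of
    365. *)
Lemma pow_step (R : realFieldType) (x l l' : R) (k f b g : nat) : 0 <= x -> 0 <= l ->
  l * 2 ^+ f <= x ^+ k -> l' * 2 ^+ g <= l * l * x ^+ b ->
  l' * 2 ^+ (f + f + g) <= x ^+ (k + k + b).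
Proof.
move=> x0 l0 h h'; rewrite !exprD.
have f0 : 0 <= 2 ^+ f :> R by exact: exprn_ge0.
apply: (@le_trans _ _ ((l * 2 ^+ f) * (l * 2 ^+ f) * x ^+ b)).
  have -> : l * 2 ^+ f * (l * 2 ^+ f) * x ^+ b = l * l * x ^+ b * (2 ^+ f * 2 ^+ f) by ring.
  have -> : l' * (2 ^+ f * 2 ^+ f * 2 ^+ g) = l' * 2 ^+ g * (2 ^+ f * 2 ^+ f) by ring.
  by rewrite ler_wpM2r // mulr_ge0.
by rewrite ler_wpM2r ?exprn_ge0 // ler_pM // mulr_ge0.
Qed.

(* Repeated squaring with mantissas rounded down to nine digits. *)
Lemma growth_pow (R : realFieldType) (x : R) : x = 1 + 307 / 1000 + 39 / 1000 ^+ 2 ->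
  2 ^+ 141 <= x ^+ 365.
Proof.
move=> xE; have x0 : 0 <= x by rewrite ?xE; clear; lra.
have h1 : x * 2 ^+ 0 <= x ^+ 1 by rewrite expr0 mulr1 expr1.
have h2 : (1 + 708 / 1000 + 350 / 1000 ^+ 2 + 947 / 1000 ^+ 3) * 2 ^+ 0 <= x ^+ 2.
  by apply: (pow_step (b := 0) (g := 0) _ _ h1) => //; rewrite ?xE; clear; lra.
have h5 : (1 + 907 / 1000 + 272 / 1000 ^+ 2 + 453 / 1000 ^+ 3) * 2 ^+ 1 <= x ^+ 5.
  by apply: (pow_step (b := 1) (g := 1) _ _ h2) => //; rewrite ?xE; clear; lra.
have h11 : (1 + 188 / 1000 + 650 / 1000 ^+ 2 + 90 / 1000 ^+ 3) * 2 ^+ 4 <= x ^+ 11.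
  by apply: (pow_step (b := 1) (g := 2) _ _ h5) => //; rewrite ?xE; clear; lra.
have h22 : (1 + 412 / 1000 + 889 / 1000 ^+ 2 + 36 / 1000 ^+ 3) * 2 ^+ 8 <= x ^+ 22.
  by apply: (pow_step (b := 0) (g := 0) _ _ h11) => //; rewrite ?xE; clear; lra.
have h45 : (1 + 304 / 1000 + 591 / 1000 ^+ 2 + 849 / 1000 ^+ 3) * 2 ^+ 17 <= x ^+ 45.
  by apply: (pow_step (b := 1) (g := 1) _ _ h22) => //; rewrite ?xE; clear; lra.
have h91 : (1 + 112 / 1000 + 263 / 1000 ^+ 2 + 977 / 1000 ^+ 3) * 2 ^+ 35 <= x ^+ 91.
  by apply: (pow_step (b := 1) (g := 1) _ _ h45) => //; rewrite ?xE; clear; lra.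
have h182 : (1 + 237 / 1000 + 131 / 1000 ^+ 2 + 154 / 1000 ^+ 3) * 2 ^+ 70 <= x ^+ 182.
  by apply: (pow_step (b := 0) (g := 0) _ _ h91) => //; rewrite ?xE; clear; lra.
have h365 : (1 + 0 / 1000 + 207 / 1000 ^+ 2 + 341 / 1000 ^+ 3) * 2 ^+ 141 <= x ^+ 365.
  by apply: (pow_step (b := 1) (g := 1) _ _ h182) => //; rewrite ?xE; clear; lra.
by apply: le_trans h365; rewrite -[leLHS]mul1r ler_wpM2r ?exprn_ge0 //; clear; lra.
Qed.

(* The witness is slightly above [2 ^ (141 / 365)]. *)
Lemma growth_exists : exists x : rat,
  [/\ 1 < x, 2 ^+ 141 <= x ^+ 365 & x < 130704%:R / 100000%:R].
Proof.
exists (1 + 307 / 1000 + 39 / 1000 ^+ 2); split; [by lra | exact: growth_pow | ].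
have -> : 130704%N = (130 * 1000 + 704)%N by apply/eqP; vm_compute; reflexivity.
have -> : 100000%N = (100 * 1000)%N by apply/eqP; vm_compute; reflexivity.
by rewrite natrD !natrM; lra.
Qed.

Lemma poly_bounded_shift f k : poly_bounded f -> poly_bounded (fun n => f (n + k)%N).
Proof.
move=> [C [e h]]; exists (C * k.+1 ^ e)%N, e => n; apply: leq_trans (h _) _.
rewrite -mulnA leq_mul2l -expnMn; apply/orP; right.
by case: e {h} => // e; rewrite leq_exp2r //; nia.
Qed.

Lemma main_cost_poly ini shf asg chk k0 : exists C e : nat,
  forall n, (main_cost ini shf asg chk k0 n <= 2 ^ exponent n * (C * n.+1 ^ e))%N.
Proof.
have [C [e bound]] : poly_bounded (fun n =>
    (body_cost ini shf asg chk (n + k0) + 14 + 17 * n.+1)%N).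
  apply: poly_bounded_add.
    apply: (@poly_bounded_shift (fun N => body_cost ini shf asg chk N + 14)%N).
    by apply: poly_bounded_add; [exact: poly_bounded_body | exact: poly_bounded_cst].
  by exists 17, 1 => N; rewrite expn1.
exists C, e => n.
apply: leq_trans (leq_mul (leqnn _) (bound n)); rewrite /main_cost mulnDr.
have := loop_cost_le ini shf asg chk (n + k0) (exponent n).
have : (17 * n.+1 <= 2 ^ exponent n * (17 * n.+1))%N by rewrite leq_pmull // expn_gt0.
lia.
Qed.

Lemma exponent_le (g : rat) n : 1 < g -> 2 ^+ 141 <= g ^+ 365 ->
  2 ^+ exponent n <= g ^+ (n + 364)%N.
Proof.
have le : (365 * ((n + 364) %/ 365) <= n + 364)%N by rewrite mulnC leq_divM.
rewrite /exponent; move: (141)%N (365)%N ((n + 364) %/ 365)%N (n + 364)%N le.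
move=> a b q m le g1 gpow.
have g0 : 0 <= g by apply: ltW; apply: lt_trans g1.
apply: le_trans (ler_weXn2l (ltW g1) le); rewrite !exprM.
by apply: lerXn2r => //; rewrite nnegrE exprn_ge0.
Qed.

(** The slack [c / g > 1] absorbs the polynomial factor, and the rounding in [exponent] contributes
    the constant [g ^+ 364]. *)
Lemma main_cost_bigO ini shf asg chk k0 (g c : rat) : 1 < g -> g < c ->
  (forall n, 2 ^+ exponent n <= g ^+ (n + 364)%N) ->
  bigO_exp (main_cost ini shf asg chk k0) c.
Proof.
move=> g1 gc gpow; have [C [e cost]] := main_cost_poly ini shf asg chk k0.
have g0 : 0 < g by exact: lt_trans g1.
have {}gc : 1 < c / g by rewrite ltr_pdivlMr // mul1r.
have [K [K0 KP]] := poly_le_exp e gc.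
exists (g ^+ 364 * (C%:R * K)), 0%N => n _.
apply: (@le_trans _ _ ((2 ^ exponent n * (C * n.+1 ^ e))%N%:R)).
  by rewrite ler_nat; exact: cost.
rewrite natrM natrX natrM natrX.
have -> : g ^+ 364 * (C%:R * K) * c ^+ n =
    g ^+ (n + 364)%N * (C%:R * (K * (c / g) ^+ n)).
  rewrite exprD expr_div_n; move: (g ^+ 364) => b; field.
  by rewrite expf_neq0 // gt_eqF.
apply: ler_pM; [exact: exprn_ge0 | | exact: gpow | ].
  by rewrite mulr_ge0 // exprn_ge0.
by rewrite ler_wpM2l.
Qed.

Local Close Scope ring_scope.

(** * PPSZ as a WHILE program *)

Lemma inv_pow2_le1 (R : realFieldType) k : (2 ^- k <= 1 :> R)%R.
Proof. by rewrite invf_le1 ?exprn_gt0 // exprn_ege1 // ler1n. Qed.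

Section Ppsz3.
Variables (R : realType) (d k : nat).

(** The clock [N = n + offset] must exceed the length of every literal list met in a refutation, at
    most [n + d]; it must make [n <= 2^-k * 2^N]; and [N >= 8] gives
    [(2 n + 1)^3 <= (2 N)^3 <= N^4], room for all clauses. *)
Definition offset : nat := d + k + 10.
Definition ppsz_prog : prog := main_prog FInit FAdvance (FAssign d) FSolved offset.
Definition ppsz_time : nat -> nat := main_cost FInit FAdvance (FAssign d) FSolved offset.

Section Input.
Variables (n : nat) (F : cnf n).
Hypothesis F3 : is_kcnf 3 F.
Local Notation N := (n + offset).

Let clauses3 : all (fun C : clause n => size C <= 3) F.
Proof. by case/andP: F3. Qed.

Let N3 : 3 <= N. Proof. by rewrite /offset; lia. Qed.
Let nN : n + d < N. Proof. by rewrite /offset; lia. Qed.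

Let FN : size F <= N ^ 4.
Proof.
apply: leq_trans (kcnf_size F3) _.
apply: (@leq_trans ((2 * N) ^ 3)).
  by rewrite leq_exp2r // /offset; lia.
by rewrite expnMn [in leqRHS]expnS leq_mul2r orbC /offset; lia.
Qed.

Let inv0 : pstate_inv ([::], enum 'I_n, 0).
Proof.
rewrite /pstate_inv /= enum_uniq size_enum_ord; case: posnP => //= n0.
by rewrite /nilp size_enum_ord n0.
Qed.

Lemma exponent_ge (y : R) : (expR (- (ln 2 * (141 / 365))) <= y)%R ->
  (1 <= (2 ^ exponent n)%:R * y ^+ n)%R.
Proof.
move=> hy; have e0 := expR_ge0 (- (ln 2 * (141 / 365)) : R)%R.
have l0 : (0 <= ln 2 :> R)%R by rewrite ln_ge0 // ler1n.
have -> : ((2 ^ exponent n)%:R = expR (ln 2 * (exponent n)%:R) :> R)%R.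
  by rewrite mulrC expRM_natl lnK ?posrE // natrX.
apply: (@le_trans _ _ (expR (ln 2 * (exponent n)%:R) * expR (- (ln 2 * (141 / 365))) ^+ n)%R).
  rewrite -expRM_natl -expRD -[leLHS]expR0 ler_expR mulrN mulrCA -mulrBr mulr_ge0 //.
  have : (n * 141 <= exponent n * 365)%N by rewrite /exponent; lia.
  by rewrite -(ler_nat R) !natrM; lra.
by rewrite ler_wpM2l ?expR_ge0 // lerXn2r ?nnegrE // (le_trans e0).
Qed.

Lemma ppsz_halts : runs_in_time ppsz_prog (cnf_tree F) (ppsz_time n).
Proof.
apply: (@main_halts _ _ _ _ _ R _ (@pstate_tree n F) (@pstate_inv n) (@advance n) (assign F d)
  (fun st => solved F st.1.1) ([::], enum 'I_n, 0)) => //.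
- exact: (FInitE nN N3 FN clauses3).
- by move=> b st; exact: (FAdvanceE nN N3 FN clauses3).
- by move=> b st; exact: inv_advance.
- by move=> b st; exact: (FAssignE nN N3 FN clauses3).
- by move=> b st; exact: inv_assign.
- by move=> st; exact: (FSolvedE nN N3 FN clauses3).
Qed.

Lemma ppsz_rejects : ~ satisfiable F ->
  forall r : (ppsz_time n).-tuple bool, ~~ accepting (run ppsz_prog (cnf_tree F) r).
Proof.
move=> nsat.
apply: (@main_rejects _ _ _ _ _ R _ (@pstate_tree n F) (@pstate_inv n) (@advance n) (assign F d)
  (fun st => solved F st.1.1) ([::], enum 'I_n, 0)) => //.
- exact: (FInitE nN N3 FN clauses3).
- by move=> b st; exact: (FAdvanceE nN N3 FN clauses3).
- by move=> b st; exact: inv_advance.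
- by move=> b st; exact: (FAssignE nN N3 FN clauses3).
- by move=> b st; exact: inv_assign.
- by move=> st; exact: (FSolvedE nN N3 FN clauses3).
by move=> [[rho W] p] ist; apply/negP => /(solved_satisfiable ist).
Qed.

Lemma ppsz_accepts :
  (expR (- (ln 2 * (141 / 365))) <=
    (1 - 2 ^- k) * expR (- (ln 2 * ppsz_rate R d)) :> R)%R ->
  satisfiable F ->
  (1 / 2 <= prob R accepting (ppsz_time n) (init ppsz_prog (cnf_tree F)))%R.
Proof.
move=> dk sat; pose y : R := ((1 - 2 ^- k) * expR (- (ln 2 * ppsz_rate R d)))%R.
apply: (@main_accepts _ _ _ _ _ R _ (@pstate_tree n F) (@pstate_inv n) (@advance n) (assign F d)
  (fun st => solved F st.1.1) ([::], enum 'I_n, 0) n _ _ _ _ _ _ _ _ _ (y ^+ n)%R) => //.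
- exact: (FInitE nN N3 FN clauses3).
- by move=> b st; exact: (FAdvanceE nN N3 FN clauses3).
- by move=> b st; exact: inv_advance.
- by move=> b st; exact: (FAssignE nN N3 FN clauses3).
- by move=> b st; exact: inv_assign.
- by move=> st; exact: (FSolvedE nN N3 FN clauses3).
- have k01 : (0 <= (2 ^- k : R) <= 1)%R.
    by apply/andP; split; [rewrite invr_ge0 exprn_ge0 | exact: inv_pow2_le1].
  apply: (@success_ge R n F d N (2 ^- k) clauses3) => //; [exact: enum_uniq | by move=> x; rewrite mem_enum | exact: leq_addr | ].
  rewrite mulrC ler_pdivlMr ?exprn_gt0 // -!natrX -natrM ler_nat.
  apply: (@leq_trans (2 ^ n * 2 ^ k)).
    by rewrite leq_mul2r ltnW ?orbT // ltn_expl.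
  by rewrite -expnD leq_exp2l // /offset; lia.
- rewrite exprn_ge0 // mulr_ge0 ?expR_ge0 //.
  by rewrite subr_ge0 inv_pow2_le1.
- exact: exponent_ge.
Qed.

End Input.
End Ppsz3.

Lemma accept_prob_ratr (R : realFieldType) p x t :
  (ratr (accept_prob p x t) = prob R accepting t (init p x))%R.
Proof. by rewrite prob_card /accept_prob fmorph_div rmorph_nat rmorphXn rmorph_nat. Qed.

From mathcomp Require Import Rstruct.

Theorem theorem1 :
  exists (p : prog) (T : nat -> nat),
    [/\ kSAT_running_time 3 p T,
        kSAT_one_sided 3 p T &
        bigO_exp T (130704%:R / 100000%:R)%R].
Proof.
(* The statement is about rationals; a model of the reals enters only through the analysis behind
   [d] and [k], and [accept_prob_ratr] translates the probabilities. *)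
have [d [k dk]] := params_exist Rdefinitions.R.
exists (ppsz_prog d k), (ppsz_time d k); split.
- by move=> n F F3; apply: (ppsz_halts Rdefinitions.R).
- move=> n F F3; split=> sat.
    rewrite -(ler_rat Rdefinitions.R) accept_prob_ratr fmorph_div rmorph1 rmorph_nat.
    exact: (ppsz_accepts F3 dk).
  rewrite /accept_prob; apply/eqP; rewrite mulf_eq0 pnatr_eq0 cards_eq0.
  apply/orP; left; apply/eqP/setP => r; rewrite !inE.
  by apply/negbTE; apply: (ppsz_rejects Rdefinitions.R).
have [g [g1 gpow gc]] := growth_exists.
by apply: (main_cost_bigO _ _ _ _ _ g1 gc) => n; exact: exponent_le.
Qed.
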